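(* Let $p>0$ be a prime, let $K$ be a global field of characteristic $p$, and let $\Gamma$ be a finitely generated group that admits a faithful (i.e. injective) representation $\Gamma\to \mathrm{PGL}_2(K)$. Then there exists a finite product $Y=T_1\times\cdots\times T_n$ of finite-valence trees such that $\Gamma$ admits a discrete and faithful representation $\Gamma\to\mathrm{Aut}(Y)$.
   Context: A global field of characteristic $p>0$ is a finite extension of $\mathbb{F}_p(t)$. A finite-valence tree is a simplicial tree in which every vertex has finite valence. $\mathrm{Aut}(Y)$ carries its usual topology (compact-open topology, equivalently pointwise convergence on vertices); a representation is discrete if its image is a discrete subgroup, and faithful if it is injective. *)

(* Defs.v *)
From HB Require Import structures.
From mathcomp Require Import all_boot all_order all_algebra all_field.
From mathcomp Require Import generic_quotient.
From mathcomp Require Import all_classical all_reals all_analysis.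

Set Implicit Arguments.
Unset Strict Implicit.
Unset Printing Implicit Defensive.

Import GRing.Theory.

Local Open Scope ring_scope.
Local Open Scope classical_set_scope.
Local Open Scope quotient_scope.

(* By classical logic, boolean predicates capture all subgroups.              *)
Definition finitely_generated (G : groupType) : Prop :=
  exists s : seq G, forall H : {pred G},
    group_closed H -> {subset s <= H} -> forall g : G, g \in H.

Section ProjectiveLinearGroup.
Variables (n : nat) (K : fieldType).

Definition GL : Type := {A : 'M[K]_n | A \in unitmx}.
HB.instance Definition _ := SubChoice.on GL.

Implicit Types A B C : GL.

Lemma GL_mul_subproof A B : val A *m val B \in unitmx.
Proof. by rewrite unitmx_mul (valP A) (valP B). Qed.
Lemma GL_inv_subproof A : invmx (val A) \in unitmx.
Proof. by rewrite unitmx_inv (valP A). Qed.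

Definition GL_one : GL := Sub 1%:M (unitmx1 K n).
Definition GL_mul A B : GL := Sub (val A *m val B) (GL_mul_subproof A B).
Definition GL_inv A : GL := Sub (invmx (val A)) (GL_inv_subproof A).

Lemma GL_mulA : associative GL_mul.
Proof. by move=> A B C; apply: val_inj; rewrite /= mulmxA. Qed.
Lemma GL_mul1 : left_id GL_one GL_mul.
Proof. by move=> A; apply: val_inj; rewrite /= mul1mx. Qed.
Lemma GL_mulr1 : right_id GL_one GL_mul.
Proof. by move=> A; apply: val_inj; rewrite /= mulmx1. Qed.
Lemma GL_mulV : left_inverse GL_one GL_inv GL_mul.
Proof. by move=> A; apply: val_inj; rewrite /= mulVmx ?(valP A). Qed.
Lemma GL_mulrV : right_inverse GL_one GL_inv GL_mul.
Proof. by move=> A; apply: val_inj; rewrite /= mulmxV ?(valP A). Qed.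

HB.instance Definition _ := isGroup.Build GL
  GL_mulA GL_mul1 GL_mulr1 GL_mulV GL_mulrV.

(* A and B lie in the same coset of the subgroup of scalar matrices.          *)
Definition proj_eq A B : bool := is_scalar_mx (val (A^-1 * B)%g).

Lemma proj_eqP A B :
  reflect (exists2 a : K, a != 0 & val B = a *: val A) (proj_eq A B).
Proof.
apply: (iffP is_scalar_mxP) => /= [[a e]|[a _ e]].
  have eB : val B = a *: val A.
    by rewrite -[LHS](mulKVmx (valP A)) e mul_mx_scalar.
  have [a0|a_neq0] := eqVneq a 0; last by exists a.
  exists 1; rewrite ?oner_neq0 // scale1r eB a0 scale0r.
  have := valP B; rewrite /= eB a0 scale0r => Bu.
  by rewrite -[RHS]mul1mx -(mulVmx Bu) mulmx0 mul0mx.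
by exists a; rewrite e -scalemxAr mulVmx ?(valP A)// scalemx1.
Qed.

Lemma proj_eq_refl : reflexive proj_eq.
Proof. by move=> A; apply/proj_eqP; exists 1; rewrite ?oner_neq0 ?scale1r. Qed.
Lemma proj_eq_imp A B : proj_eq A B -> proj_eq B A.
Proof.
move=> /proj_eqP[a a0 e]; apply/proj_eqP; exists a^-1; first by rewrite invr_eq0.
by rewrite e scalerA mulVf // scale1r.
Qed.
Lemma proj_eq_sym : symmetric proj_eq.
Proof. by move=> A B; apply/idP/idP; exact: proj_eq_imp. Qed.
Lemma proj_eq_trans : transitive proj_eq.
Proof.
move=> B A C /proj_eqP[a a0 eB] /proj_eqP[b b0 eC]; apply/proj_eqP.
by exists (b * a); rewrite ?mulf_neq0 // eC eB scalerA.
Qed.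

Canonical proj_equiv :=
  EquivRel proj_eq proj_eq_refl proj_eq_sym proj_eq_trans.

Definition PGL : Type := {eq_quot proj_equiv}.
HB.instance Definition _ := Choice.on PGL.
HB.instance Definition _ := EqQuotient.on PGL.

Definition PGL_one : PGL := \pi_PGL (1%g : GL).
Definition PGL_mul (x y : PGL) : PGL := \pi_PGL (repr x * repr y)%g.
Definition PGL_inv (x : PGL) : PGL := \pi_PGL (repr x)^-1%g.

Lemma PGL_piP A B : reflect (\pi_PGL A = \pi_PGL B) (proj_eq A B).
Proof. exact: (eqmodP proj_equiv). Qed.

Lemma PGL_repr A : proj_eq A (repr (\pi_PGL A)).
Proof. by apply/PGL_piP; rewrite reprK. Qed.

Lemma PGL_piM A B : \pi_PGL (A * B)%g = PGL_mul (\pi_PGL A) (\pi_PGL B).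
Proof.
apply/PGL_piP/proj_eqP.
have /proj_eqP[a a0 eA] := PGL_repr A; have /proj_eqP[b b0 eB] := PGL_repr B.
exists (a * b); rewrite ?mulf_neq0 //=.
by rewrite eA eB -scalemxAl -scalemxAr scalerA.
Qed.

Lemma PGL_piV A : \pi_PGL (A^-1)%g = PGL_inv (\pi_PGL A).
Proof.
apply/PGL_piP/proj_eqP.
have /proj_eqP[a a0 eA] := PGL_repr A.
exists a^-1; rewrite ?invr_eq0 //= eA invmxZ // -eA.
exact: (valP (repr (\pi_PGL A))).
Qed.

Lemma PGL_piW (P : PGL -> Prop) : (forall A, P (\pi_PGL A)) -> forall x, P x.
Proof. by move=> Ppi x; rewrite -[x]reprK. Qed.

Lemma PGL_mulA : associative PGL_mul.
Proof.
move=> x y z; elim/PGL_piW: x => A; elim/PGL_piW: y => B; elim/PGL_piW: z => C.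
by rewrite -!PGL_piM mulgA.
Qed.
Lemma PGL_mul1 : left_id PGL_one PGL_mul.
Proof. by move=> x; elim/PGL_piW: x => A; rewrite -!PGL_piM mul1g. Qed.
Lemma PGL_mulr1 : right_id PGL_one PGL_mul.
Proof. by move=> x; elim/PGL_piW: x => A; rewrite -!PGL_piM mulg1. Qed.
Lemma PGL_mulV : left_inverse PGL_one PGL_inv PGL_mul.
Proof. by move=> x; elim/PGL_piW: x => A; rewrite -PGL_piV -!PGL_piM mulVg. Qed.
Lemma PGL_mulrV : right_inverse PGL_one PGL_inv PGL_mul.
Proof. by move=> x; elim/PGL_piW: x => A; rewrite -PGL_piV -!PGL_piM mulgV. Qed.

HB.instance Definition _ := isGroup.Build PGL
  PGL_mulA PGL_mul1 PGL_mulr1 PGL_mulV PGL_mulrV.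

End ProjectiveLinearGroup.

(* The bound on the size excludes the degenerate circuits x, y, x that        *)
(* traverse an edge back and forth.                                           *)
Record tree := Tree {
  vertex :> choiceType;
  adj : rel vertex;
  adj_sym : symmetric adj;
  adj_irr : irreflexive adj;
  tree_nonempty : exists x : vertex, True;
  tree_connected : forall x y : vertex,
    exists2 c : seq vertex, path adj x c & last x c = y;
  tree_acyclic : forall c : seq vertex, ucycle adj c -> (size c <= 2)%N }.

Definition finite_valence (T : tree) : Prop :=
  forall x : T, finite_set [set y : T | adj x y].

Definition simplex (T : tree) (s : set T) : Prop :=
  exists x y : T, (x = y \/ adj x y) /\ s = [set x; y].

Section ProductOfTrees.
Variables (n : nat) (T : 'I_n -> tree).

(* The product complex is recorded by its vertices and by the vertex sets of  *)
(* its cells, which are the products of simplices of the factors.             *)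
Definition prod_vertex : Type := forall i : 'I_n, T i.
HB.instance Definition _ := Choice.on prod_vertex.

Definition cell (C : set prod_vertex) : Prop :=
  exists2 s : forall i, set (T i), (forall i, simplex (s i)) &
    C = [set v | forall i, s i (v i)].

(* Automorphisms of the cell complex; they may permute the factors.           *)
Record AutProd := MkAutProd {
  aut_fun :> prod_vertex -> prod_vertex;
  aut_bij : bijective aut_fun;
  aut_cell : forall C : set prod_vertex, cell (aut_fun @` C) <-> cell C }.
HB.instance Definition _ := gen_eqMixin AutProd.
HB.instance Definition _ := gen_choiceMixin AutProd.

Lemma aut_inj (f g : AutProd) : aut_fun f =1 aut_fun g -> f = g.
Proof.
case: f g => [f fb fc] [g gb gc] /= /funext fg; subst g.
by congr MkAutProd; exact: Prop_irrelevance.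
Qed.

Lemma aut_one_cell (C : set prod_vertex) : cell (id @` C) <-> cell C.
Proof. by rewrite image_id. Qed.
Definition aut_one : AutProd := MkAutProd (Bijective (fun=> erefl) (fun=> erefl)) aut_one_cell.

Lemma aut_mul_cell (f g : AutProd) (C : set prod_vertex) :
  cell ((f \o g) @` C) <-> cell C.
Proof. by rewrite -image_comp !aut_cell. Qed.
Definition aut_mul (f g : AutProd) : AutProd :=
  MkAutProd (bij_comp (aut_bij f) (aut_bij g)) (aut_mul_cell f g).

Lemma aut_inv_subproof (f : AutProd) :
  exists g : prod_vertex -> prod_vertex, cancel f g /\ cancel g f.
Proof. by case: (aut_bij f) => g fK gK; exists g. Qed.
Definition aut_inv_fun (f : AutProd) := projT1 (cid (aut_inv_subproof f)).
Lemma aut_inv_funK (f : AutProd) : cancel f (aut_inv_fun f).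
Proof. by rewrite /aut_inv_fun; case: cid => ? []. Qed.
Lemma aut_inv_funVK (f : AutProd) : cancel (aut_inv_fun f) f.
Proof. by rewrite /aut_inv_fun; case: cid => ? []. Qed.

Lemma aut_inv_cell (f : AutProd) (C : set prod_vertex) :
  cell (aut_inv_fun f @` C) <-> cell C.
Proof.
rewrite -(aut_cell f) image_comp (_ : f \o _ = id) ?image_id//.
exact/funext/aut_inv_funVK.
Qed.
Definition aut_inv (f : AutProd) : AutProd :=
  MkAutProd (Bijective (@aut_inv_funVK f) (@aut_inv_funK f)) (aut_inv_cell f).

Lemma aut_mulA : associative aut_mul.
Proof. by move=> f g h; exact: aut_inj. Qed.
Lemma aut_mul1 : left_id aut_one aut_mul.
Proof. by move=> f; exact: aut_inj. Qed.
Lemma aut_mulr1 : right_id aut_one aut_mul.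
Proof. by move=> f; exact: aut_inj. Qed.
Lemma aut_mulV : left_inverse aut_one aut_inv aut_mul.
Proof. by move=> f; apply: aut_inj => v /=; exact: aut_inv_funK. Qed.
Lemma aut_mulrV : right_inverse aut_one aut_inv aut_mul.
Proof. by move=> f; apply: aut_inj => v /=; exact: aut_inv_funVK. Qed.

HB.instance Definition _ := isGroup.Build AutProd
  aut_mulA aut_mul1 aut_mulr1 aut_mulV aut_mulrV.

(* Pointwise convergence on the (discrete) vertex set.                        *)
Definition aut_to_ptws (f : AutProd) :
  {ptws prod_vertex -> discrete_topology prod_vertex} := f.
HB.instance Definition _ := Topological.copy AutProd (initial_topology aut_to_ptws).

End ProductOfTrees.

Definition discrete_subset (X : topologicalType) (A : set X) : Prop :=
  A `<=` isolated A.

(* Main.v *)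
From HB Require Import structures.
Require Import Defs.
From mathcomp Require Import all_boot all_order all_algebra all_field.
From mathcomp Require Import generic_quotient.
From mathcomp Require Import all_classical all_reals all_analysis.
From mathcomp Require Import zify ring.

(** The group acts on the product of the Bruhat-Tits trees of finitely many
  places of K; the places have to be few enough to be finite in number and many
  enough for the action to be discrete.

  The places.  Let F be the finite field of constants.  The entries of lifts of
  the generators and of their inverses are integral over F[s] for some s in K
  that is transcendental over F and such that K is finite over F(s)
  (normal_parameter, after Noether).  The places are the valuation rings of K
  that do not contain s.  Two facts about them carry the proof.
  - A weak product formula: a nonzero element x integral over F[s] is not a
    nonunit at every place (nonzero_integral_valuation).  By Chevalley's
    extension theorem (valuation_ring_avoiding) a place containing 1/x exists
    unless s is integral over F[1/x]; but then x, and with it s, would be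
    algebraic over F.
  - A counting argument: D + 1 elements of K are dependent over F[s], and the
    leading coefficients of a relation give a relation modulo 1/s over F.  Hence
    M / (1/s) M has at most |F|^D elements for every F[1/s]-submodule M of K
    (residues).  For M a place, this makes the place discrete with finite residue
    field (valuation_ring_discrete).  For M the intersection of the places, it
    leaves finitely many places (finitely_many_places), and shows together with
    the first fact that an element integral over F[s] and at all places is zero
    or a root of unity (everywhere_integral_nonunit).

  The trees.  The vertices are the classes of frames of K^2 modulo scalars and
  integral changes of basis, and adjacency is read on the valuation of a
  determinant, so that invariance under GL_2 is immediate.  The Hermite normal
  form identifies the vertices with the balls of K; a ball has a unique parent,
  two balls have a common ancestor, and such a graph is a tree (parent_tree).

  Discreteness.  Let g be a matrix that is, like its inverse, integral over F[s],
  and that fixes the base vertex of every tree.  The products of an entry of g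
  and an entry of its inverse are insensitive to the scalars, and they are
  integral at all places, hence zero or roots of unity.  If g also fixes three
  neighbours of the base vertex in one tree, enough of these products are
  nonunits there, hence zero, to make g a scalar (scalar_of_fixed_balls).  So
  finitely many vertices of the product have a trivial common stabilizer, which
  gives faithfulness and discreteness at once (discrete_subgroup). *)

Set Implicit Arguments.
Unset Strict Implicit.
Unset Printing Implicit Defensive.

Import Order.TTheory GRing.Theory Num.Theory.

Local Open Scope ring_scope.
Local Open Scope classical_set_scope.
Local Open Scope quotient_scope.

(** * Valuation rings that avoid an element *)

Section ValuationRings.
Variables (F : finFieldType) (K : fieldType) (iota : {rmorphism F -> K}).
Implicit Types (V : set K) (s u x y : K) (p q : {poly K}).

Record subalgebra V : Prop := Subalgebra {
  subalg_const : forall a, V (iota a);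
  subalg_sub : forall x y, V x -> V y -> V (x - y);
  subalg_mul : forall x y, V x -> V y -> V (x * y) }.

Section SubalgebraTheory.
Variables (V : set K) (algV : subalgebra V).

Lemma subalg1 : V 1. Proof. by rewrite -(rmorph1 iota); apply: subalg_const. Qed.
Lemma subalg0 : V 0. Proof. by rewrite -(rmorph0 iota); apply: subalg_const. Qed.
Lemma subalg_opp x : V x -> V (- x).
Proof. by rewrite -sub0r; apply: subalg_sub algV _ _ subalg0. Qed.
Lemma subalg_add x y : V x -> V y -> V (x + y).
Proof. by move=> Vx /subalg_opp Vy; rewrite -[y]opprK; apply: subalg_sub. Qed.
Lemma subalg_exp x n : V x -> V (x ^+ n).
Proof.
move=> Vx; elim: n => [|n IHn]; first exact: subalg1.
by rewrite exprS; apply: subalg_mul.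
Qed.
Lemma subalg_sum (I : Type) (r : seq I) (P : pred I) (E : I -> K) :
  (forall i, P i -> V (E i)) -> V (\sum_(i <- r | P i) E i).
Proof. exact: (big_ind V subalg0 subalg_add). Qed.

Definition adjoin u : set K :=
  [set z | exists2 p : {poly K}, (forall i, V p`_i) & z = p.[u]].

Lemma sub_adjoin u : V `<=` adjoin u.
Proof.
move=> x Vx; exists x%:P; last by rewrite hornerC.
by move=> i; rewrite coefC; case: eqP => // _; apply: subalg0.
Qed.

Lemma adjoin_id u : adjoin u u.
Proof.
exists 'X; last by rewrite hornerX.
by move=> i; rewrite coefX; case: eqP => _; [apply: subalg1 | apply: subalg0].
Qed.

Lemma adjoin_subalgebra u : subalgebra (adjoin u).
Proof.
split=> [a|_ _ [p Vp ->] [q Vq ->]|_ _ [p Vp ->] [q Vq ->]].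
- by apply: sub_adjoin; apply: subalg_const.
- by exists (p - q) => [i|]; rewrite ?coefB ?hornerE //; apply: subalg_sub.
- exists (p * q) => [i|]; rewrite ?hornerE // coefM; apply: subalg_sum => j _.
  exact: subalg_mul.
Qed.

End SubalgebraTheory.

(** Dividing s = q(1/u) by s and collecting the constant term leaves the unit
  1 - q_0 / s of V, so that a power u^n is a combination of strictly lower ones
  as soon as n is at least the degree of q; the leading term of p can be
  rewritten with it. *)
Lemma lower_degree V s u p q :
    subalgebra V -> V s^-1 -> ~ V s ->
    (forall x, V x -> 1 - s^-1 * x != 0 -> V (1 - s^-1 * x)^-1) ->
    (forall i, V p`_i) -> (forall i, V q`_i) -> u != 0 ->
    s = p.[u] -> s = q.[u^-1] -> (size q <= size p)%N ->
  exists p', [/\ forall i, V p'`_i, s = p'.[u] & (size p' < size p)%N].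
Proof.
move=> algV Vs' Vs unitV Vp Vq u0 sp sq szqp.
have s0 : s != 0 by apply/eqP => s0; apply: Vs; rewrite s0; apply: subalg0.
pose w := 1 - s^-1 * q`_0.
have w0 : w != 0.
  apply/eqP => /subr0_eq /(congr1 (fun z => s * z)).
  by rewrite mulr1 mulrA divff // mul1r => sq0; apply: Vs; rewrite sq0.
have Vw : V w^-1 by apply: unitV.
have szp : (0 < size p)%N.
  rewrite lt0n size_poly_eq0; apply/eqP => p0.
  by move: s0; rewrite sp p0 horner0 eqxx.
have [n szpE] : exists n, size p = n.+1 by exists (size p).-1; rewrite prednK.
pose c j := s^-1 * q`_j / w.
have Vc j : V (c j) by apply: subalg_mul => //; apply: subalg_mul.
have un : u ^+ n = \sum_(j < n) c j.+1 * u ^+ (n - j.+1).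
  have : 1 = s^-1 * \sum_(j < n.+1) q`_j * u^-1 ^+ j.
    by rewrite -(@horner_coef_wide _ n.+1) -?szpE // -sq mulVf.
  rewrite big_ord_recl expr0 mulr1 mulrDr => /(congr1 (fun z => z - s^-1 * q`_0)).
  rewrite addrAC subrr add0r -/w => /(congr1 (fun z => u ^+ n / w * z)).
  rewrite divfK // => ->.
  rewrite !mulr_sumr; apply: eq_bigr => j _ /=; rewrite /bump leq0n add1n.
  rewrite exprVn /c (_ : u ^+ n = u ^+ (n - j.+1) * u ^+ j.+1); last first.
    by rewrite -exprD subnK.
  have uj : u ^+ j.+1 != 0 by rewrite expf_neq0.
  by field; rewrite w0 s0 uj.
pose p' := \poly_(i < n) (p`_i + p`_n * c (n - i)%N).
exists p'; split.
- move=> i; rewrite coef_poly; case: ifP => _; last exact: subalg0.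
  by apply: subalg_add => //; apply: subalg_mul.
- rewrite sp horner_coef szpE big_ord_recr /= un mulr_sumr.
  rewrite (reindex_inj rev_ord_inj) /= -big_split /= horner_poly.
  rewrite [RHS](reindex_inj rev_ord_inj) /=; apply: eq_bigr => j _.
  by rewrite subKn ?ltn_ord // mulrDl mulrA.
- by rewrite szpE ltnS size_poly.
Qed.

(** Descent on the degrees of two expressions of s, one as a polynomial in u and
  one as a polynomial in 1/u. *)
Lemma adjoin_exclusive V s u :
    subalgebra V -> V s^-1 -> ~ V s ->
    (forall x, V x -> 1 - s^-1 * x != 0 -> V (1 - s^-1 * x)^-1) ->
  u != 0 -> adjoin V u s -> adjoin V u^-1 s -> False.
Proof.
move=> algV Vs' Vs unitV u0 [p Vp sp] [q Vq sq].
have [N leN] := ubnP (size p + size q).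
elim: N u p q u0 Vp sp Vq sq leN => // N IHN u p q u0 Vp sp Vq sq leN.
have [szqp|/ltnW szpq] := leqP (size q) (size p).
  have [p' [Vp' sp' ltp']] := lower_degree algV Vs' Vs unitV Vp Vq u0 sp sq szqp.
  apply: (IHN u p' q) => //; move: leN; rewrite !ltnS; apply: leq_trans.
  by rewrite ltn_add2r.
have u0' : u^-1 != 0 by rewrite invr_eq0.
have sp1 : s = p.[u^-1^-1] by rewrite invrK.
have [q' [Vq' sq' ltq']] := lower_degree algV Vs' Vs unitV Vq Vp u0' sq sp1 szpq.
apply: (IHN u p q') => //; move: leN; rewrite !ltnS; apply: leq_trans.
by rewrite ltn_add2l.
Qed.

Record valuation_ring V : Prop := ValuationRing {
  valring_subalg : subalgebra V;
  valring_total : forall x, V x \/ V x^-1 }.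

(** Chevalley's extension theorem: a subring that is maximal among those that
  avoid s and contain 1/s is a valuation ring.  Maximality makes 1 - x/s a unit
  for x in V, since inverting it cannot produce s; then s cannot be in both V[u]
  and V[1/u], so that one of them is V. *)
Theorem valuation_ring_avoiding (R : set K) s :
    subalgebra R -> R s^-1 -> ~ R s ->
  exists V, [/\ valuation_ring V, R `<=` V & ~ V s].
Proof.
move=> algR Rs' Rs.
pose good := [set V | [/\ subalgebra V, R `<=` V & ~ V s]].
have goodR : good R by split.
(* The empty set is admitted for the empty chain, whose union is empty. *)
have [| V [PV maxV]] := @Zorn_bigcup K [set V | V = set0 \/ good V].
  move=> C CP totC /=.
  have [[X CX gX]|noX] := pselect (exists2 X, C X & good X); last first.
    left; apply/seteqP; split=> // x [X CX Xx].
    by case: (CP X CX) => [X0|gX]; [rewrite X0 in Xx | case: noX; exists X].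
  right; case: (gX) => algX RX Xs.
  have goodC Y y : C Y -> Y y -> good Y.
    by move=> CY Yy; case: (CP Y CY) => // Y0; rewrite Y0 in Yy.
  have common y z : (\bigcup_(Y in C) Y) y -> (\bigcup_(Y in C) Y) z ->
      exists Y, [/\ C Y, good Y, Y y & Y z].
    move=> [Y CY Yy] [Z CZ Zz]; case: (totC Y Z CY CZ) => [YZ|ZY].
      by exists Z; split=> //; [apply: goodC Zz | apply: YZ].
    by exists Y; split=> //; [apply: goodC Yy | apply: ZY].
  split.
  - split=> [a|y z Uy Uz|y z Uy Uz].
    + by exists X => //; apply: subalg_const.
    + have [Y [CY [algY _ _] Yy Yz]] := common y z Uy Uz.
      by exists Y => //; apply: subalg_sub.
    + have [Y [CY [algY _ _] Yy Yz]] := common y z Uy Uz.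
      by exists Y => //; apply: subalg_mul.
  - by move=> x Rx; exists X => //; apply: RX.
  - by move=> [Y CY Ys]; have [] := goodC _ _ CY Ys.
have {PV} [algV RV Vs] : good V.
  case: PV => [V0|//]; case: (maxV R); last by right.
  by rewrite V0; split=> // /(_ _ Rs').
have maxV' W : subalgebra W -> V `<=` W -> ~ W s -> W `<=` V.
  move=> algW VW Ws x Wx; apply: contrapT => Vx.
  apply: (maxV W); last by right; split=> // y /RV /VW.
  by split=> // /(_ _ Wx).
have s0 : s != 0 by apply/eqP => s0; apply: Vs; rewrite s0; apply: subalg0.
have Vs' : V s^-1 by apply: RV.
have unitV x : V x -> 1 - s^-1 * x != 0 -> V (1 - s^-1 * x)^-1.
  move=> Vx; set w := 1 - _ => w0.
  have Vw : V w by apply: subalg_sub (subalg1 algV) (subalg_mul _ _ _).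
  have wX k : exists2 b, V b & w ^+ k = 1 - s^-1 * b.
    elim: k => [|k [b Vb wk]].
      by exists 0; rewrite ?mulr0 ?subr0 //; apply: subalg0.
    exists (b + x * w ^+ k).
      by apply: subalg_add => //; apply: subalg_mul => //; apply: subalg_exp.
    by rewrite exprS {1}/w mulrBl mul1r {1}wk mulrDr opprD addrA mulrA.
  pose W := [set z | exists k, V (z * w ^+ k)].
  have WV : V `<=` W by move=> z Vz; exists 0%N; rewrite mulr1.
  have WvE y z k l : y * w ^+ k * (z * w ^+ l) = y * z * w ^+ (k + l).
    by rewrite exprD; ring.
  apply: (maxV' W) => //; last by exists 1%N; rewrite mulVf //; apply: subalg1.
    split=> [a|y z [k Vk] [l Vl]|y z [k Vk] [l Vl]].
    - by apply: WV; apply: subalg_const.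
    - exists (k + l)%N; rewrite exprD mulrBl.
      rewrite (_ : _ - _ = y * w ^+ k * w ^+ l - z * w ^+ l * w ^+ k); last by ring.
      by apply: subalg_sub => //; apply: subalg_mul => //; apply: subalg_exp.
    - by exists (k + l)%N; rewrite -WvE; apply: subalg_mul.
  move=> [k Vk]; have [b Vb wk] := wX k; apply: Vs.
  rewrite -[s](subrK b); apply: subalg_add => //.
  by rewrite (_ : s - b = s * w ^+ k) // wk mulrBr mulr1 mulrA divff // mul1r.
exists V; split=> //; split=> // u.
have [->|u0] := eqVneq u 0; first by left; apply: subalg0.
have [su|nsu] := pselect (adjoin V u s).
  right; apply: (maxV' (adjoin V u^-1)).
  - exact: adjoin_subalgebra.
  - exact: sub_adjoin.
  - exact: adjoin_exclusive su.
  - exact: adjoin_id.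
left; apply: (maxV' (adjoin V u)) => //.
- exact: adjoin_subalgebra.
- exact: sub_adjoin.
- exact: adjoin_id.
Qed.

End ValuationRings.

(** * Integrality and a weak product formula *)

Section Evaluation.
Variables (R K : comNzRingType) (phi : {rmorphism R -> K}) (s : K).

Definition evalp : {poly R} -> K := horner_morph (fun a => mulrC s (phi a)).
HB.instance Definition _ := GRing.RMorphism.on evalp.

Lemma evalpC a : evalp a%:P = phi a. Proof. exact: horner_morphC. Qed.
Lemma evalpX : evalp 'X = s. Proof. exact: horner_morphX. Qed.
Lemma evalpE q : evalp q = (map_poly phi q).[s]. Proof. by []. Qed.
Lemma evalp_sum (q : {poly R}) n : (size q <= n)%N ->
  evalp q = \sum_(i < n) phi q`_i * s ^+ i.
Proof.
move=> szq; rewrite evalpE (@horner_coef_wide _ n).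
  by apply: eq_bigr => i _; rewrite coef_map.
exact: leq_trans (size_poly _ _) szq.
Qed.

End Evaluation.

Section Integrality.
Variable K : fieldType.

Lemma integral_trans (R S L : comNzRingType) (f : {rmorphism R -> L})
    (g : {rmorphism S -> L}) x :
  (forall a, integralOver f (g a)) -> integralOver g x -> integralOver f x.
Proof.
move=> fg [q mon_q qx]; apply: (integral_root_monic _ qx).
  exact: monic_map.
by apply/integral_poly => i; rewrite coef_map; apply: fg.
Qed.

Lemma integral_evalp (R S L : comNzRingType) (f : {rmorphism R -> L})
    (g : {rmorphism S -> L}) s :
  (forall a, integralOver f (g a)) -> integralOver f s ->
  forall q, integralOver f (evalp g s q).
Proof.
move=> fg fs q; rewrite evalpE; apply: integral_horner => //.
by apply/integral_poly => i; rewrite coef_map; apply: fg.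
Qed.

(** Multiplying by a power of y turns an expression of y as a polynomial in 1/y
  into a monic equation; the next lemma divides by that power. *)
Lemma integral_evalp_inv (R : comNzRingType) (f : {rmorphism R -> K}) y q :
  y != 0 -> y = evalp f y^-1 q -> integralOver f y.
Proof.
move=> y0 yE; pose n := size q.
exists ('X^(n.+1) - \poly_(i < n.+1) q`_(n - i)%N).
  apply/monicP; rewrite lead_coefDl ?lead_coefXn //.
  by rewrite size_polyN size_polyXn ltnS size_poly.
rewrite rootE rmorphB /= map_polyXn hornerD hornerN hornerXn subr_eq0; apply/eqP.
rewrite exprSr {2}yE (@evalp_sum _ _ _ _ _ n.+1) ?leqnSn // mulr_sumr.
rewrite (@horner_coef_wide _ n.+1); last first.
  exact: leq_trans (size_poly _ _) (size_poly _ _).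
rewrite (reindex_inj rev_ord_inj) /=; apply: eq_bigr => i _.
rewrite coef_map coef_poly ltn_ord subSS exprVn mulrCA; congr (_ * _).
have le_in : (i <= n)%N by rewrite -ltnS.
by rewrite -{1}(subnK le_in) exprD mulrAC divff ?mul1r // expf_neq0.
Qed.

Lemma integral_evalp_invP (R : comNzRingType) (f : {rmorphism R -> K}) y :
  y != 0 -> integralOver f y -> exists q, y = evalp f y^-1 q.
Proof.
move=> y0 [p mon_p py0].
have [n szp] : exists n, size p = n.+1.
  by exists (size p).-1; rewrite prednK // lt0n size_poly_eq0 monic_neq0.
have pn : p`_n = 1 by rewrite -(monicP mon_p) lead_coefE szp.
case: n szp pn => [|n] szp pn.
  have p1 : p = 1 by rewrite (size1_polyC (eq_leq szp)) pn.
  by move: py0; rewrite p1 rmorph1 (negPf (root1 _)).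
exists (- \poly_(i < n.+1) p`_(n - i)).
have : (map_poly f p).[y] = 0 by apply/eqP.
rewrite -evalpE (@evalp_sum _ _ _ _ _ n.+2) ?szp // big_ord_recr /= pn rmorph1 mul1r.
move/eqP; rewrite addrC addr_eq0 exprSr => /eqP yn.
have yn0 : y ^+ n != 0 by rewrite expf_neq0.
apply: (mulfI yn0); rewrite yn rmorphN /= mulrN; congr (- _).
rewrite (@evalp_sum _ _ _ _ _ n.+1) ?size_poly // mulr_sumr.
rewrite (reindex_inj rev_ord_inj) /=; apply: eq_bigr => i _.
rewrite coef_poly ltn_ord subSS exprVn [RHS]mulrCA; congr (_ * _).
have le_in : (i <= n)%N by rewrite -ltnS.
have yi0 : y ^+ i != 0 by rewrite expf_neq0.
by apply: (mulIf yi0); rewrite divfK // -exprD subnK.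
Qed.

End Integrality.

Section ProductFormula.
Variables (F : finFieldType) (K : fieldType) (iota : {rmorphism F -> K}).
Variables (s : K) (s_trans : ~ integralOver iota s).

(** A place containing 1/x and avoiding s is missing only if s is in F[1/x, 1/s],
  that is, integral over F[1/x].  As x is integral over F[s], it would be
  integral over F[1/x], hence algebraic over F, and so would s. *)
Lemma nonzero_integral_valuation x :
    x != 0 -> integralOver (evalp iota s) x ->
  exists V, [/\ valuation_ring iota V, ~ V s & V x^-1].
Proof.
move=> x0 intx.
have s0 : s != 0.
  by apply/eqP => s0; apply: s_trans; rewrite s0; apply: mxpoly.integral0.
pose R := [set z | exists q, z = evalp (evalp iota x^-1) s^-1 q].
have [|||V [valV RV Vs]] :=
    @valuation_ring_avoiding _ _ iota R s.
- split=> [a|z w [p ->] [q ->]|z w [p ->] [q ->]].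
  + by exists a%:P%:P; rewrite evalpC /= evalpC.
  + by exists (p - q); rewrite rmorphB.
  + by exists (p * q); rewrite rmorphM.
- by exists 'X; rewrite evalpX.
- case=> q /(integral_evalp_inv s0) ints; apply: s_trans.
  have intx' : integralOver (evalp iota x^-1) x.
    apply: integral_trans intx => a; apply: integral_evalp => // b.
    by rewrite -(evalpC iota x^-1); apply: integral_id.
  have [p xE] := integral_evalp_invP x0 intx'.
  have intx1 : integralOver iota x.
    apply: (@integral_evalp_inv _ _ _ _ (p.['X])) => //.
    by rewrite [LHS]xE -horner_map /= evalpX.
  apply: integral_trans ints => a; apply: integral_evalp => [b|].
    exact: integral_id.
  exact: integral_inv.
by exists V; split=> //; apply: RV; exists 'X%:P; rewrite evalpC /= evalpX.
Qed.

End ProductFormula.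

(** * Residues modulo 1/s *)

Section AvoidingPlaces.
Variables (F : finFieldType) (K : fieldType) (iota : {rmorphism F -> K}).
Variables (s : K) (D : nat).
Implicit Types (M V : set K) (x y z : K).

Local Notation ev := (evalp iota s).

Hypothesis ev_dependent : forall x : 'I_D.+1 -> K,
  exists q : 'I_D.+1 -> {poly F},
    (exists i, q i != 0) /\ \sum_i ev (q i) * x i = 0.

(** The F[1/s]-submodules of K. *)
Record inverse_module M : Prop := InverseModule {
  imod0 : M 0;
  imod_sub : forall x y, M x -> M y -> M (x - y);
  imod_scale : forall a x, M x -> M (iota a * x);
  imod_div : forall x, M x -> M (s^-1 * x) }.

Section InverseModuleTheory.
Variables (M : set K) (modM : inverse_module M) (s0 : s != 0).

Lemma imod_add x y : M x -> M y -> M (x + y).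
Proof.
move=> Mx My; rewrite -[y]opprK; apply: (imod_sub modM) => //.
by rewrite -sub0r; apply: (imod_sub modM) => //; apply: (imod0 modM).
Qed.

Lemma imod_sum (I : Type) (r : seq I) (P : pred I) (E : I -> K) :
  (forall i, P i -> M (E i)) -> M (\sum_(i <- r | P i) E i).
Proof. exact: (big_ind M (imod0 modM) imod_add). Qed.

Lemma imod_divX x n : M x -> M (s^-1 ^+ n * x).
Proof.
move=> Mx; elim: n => [|n IHn]; first by rewrite mul1r.
by rewrite exprS -mulrA; apply: (imod_div modM).
Qed.

(** The lower terms of q(s) / s^n are multiples of 1/s. *)
Lemma imod_leading (q : {poly F}) n x : (size q <= n.+1)%N -> M x ->
  M (s * (s^-1 ^+ n * ev q * x - iota q`_n * x)).
Proof.
move=> szq Mx; rewrite (evalp_sum _ _ szq) big_ord_recr /=.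
rewrite [s^-1 ^+ n * _]mulrDr mulrDl [X in _ + X - _](_ : _ = iota q`_n * x).
  rewrite addrK mulr_sumr mulr_suml mulr_sumr; apply: imod_sum => i _.
  have si : s * s ^+ i != 0 by rewrite mulf_neq0 ?expf_neq0.
  have s'i : s ^+ (n - i.+1) != 0 by rewrite expf_neq0.
  rewrite [X in M X](_ : _ = s^-1 ^+ (n - i.+1) * (iota q`_i * x)).
    by apply: imod_divX; apply: (imod_scale modM).
  have sn : s ^+ n = s ^+ (n - i.+1) * (s * s ^+ i).
    by rewrite -exprS -exprD subnK.
  rewrite !exprVn sn; move: si; rewrite mulf_eq0 negb_or => /andP[_ si].
  by field; rewrite s0 si s'i.
by rewrite mulrCA exprVn mulVf ?mulr1 ?expf_neq0.
Qed.

Definition independent_mod m (x : 'I_m -> K) : Prop :=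
  (forall i, M (x i)) /\
  forall c : 'I_m -> F, M (s * \sum_i iota (c i) * x i) -> forall i, c i = 0.

(** In a relation with coefficients q_i(s), the coefficients of the top degree
  give a relation modulo 1/s over the constants. *)
Lemma dependent_mod (x : 'I_D.+1 -> K) : ~ independent_mod x.
Proof.
move=> [Mx indx]; have [q [[j qj] sum0]] := ev_dependent x.
have [m qm ltm] := @arg_maxnP _ j (fun i => q i != 0) (fun i => size (q i)) qj.
pose n := (size (q m)).-1.
have szm : size (q m) = n.+1 by rewrite prednK // lt0n size_poly_eq0.
have szq i : (size (q i) <= n.+1)%N.
  have [->|qi] := eqVneq (q i) 0; first by rewrite size_poly0.
  by rewrite -szm; apply: ltm.
have : iota (q m)`_n = 0.
  rewrite (indx (fun i => (q i)`_n) _ m) ?rmorph0 //.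
  have <- : \sum_i (iota (q i)`_n * x i - s^-1 ^+ n * ev (q i) * x i) =
            \sum_i iota (q i)`_n * x i.
    rewrite sumrB; under [X in _ - X]eq_bigr do rewrite -mulrA.
    by rewrite -mulr_sumr sum0 mulr0 subr0.
  rewrite mulr_sumr; apply: imod_sum => i _.
  rewrite -opprB mulrN -[- (s * _)]sub0r; apply: (imod_sub modM) => //.
    exact: (imod0 modM).
  exact: imod_leading.
move/eqP; rewrite fmorph_eq0; apply/negP.
by rewrite -[n]/((size (q m)).-1) -lead_coefE lead_coef_eq0.
Qed.

(** The F-combinations of a maximal family that is independent modulo 1/s
  represent all classes.  The bound on their number does not depend on M. *)
Lemma residues :
  exists R : seq K, [/\ (size R <= #|F| ^ D)%N, forall r, r \in R -> M r &
    forall x, M x -> exists2 r, r \in R & M (s * (x - r))].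
Proof.
have [m [lemD [x [Mx indx]] maxm]] : exists m, [/\ (m <= D)%N,
    exists x : 'I_m -> K, independent_mod x &
    forall x : 'I_m.+1 -> K, ~ independent_mod x].
  apply: contrapT => noM.
  suff P m : (m <= D.+1)%N -> exists x : 'I_m -> K, independent_mod x.
    by have [x /dependent_mod] := P D.+1 (leqnn _).
  elim: m => [_|m IHm ltm].
    by exists (fun=> 0); split=> [i|c _ i]; case: i.
  apply: contrapT => nox; apply: noM; exists m; split=> //.
    exact/IHm/ltnW.
  by move=> x ix; apply: nox; exists x.
pose comb (c : {ffun 'I_m -> F}) := \sum_i iota (c i) * x i.
have Mcomb c : M (comb c).
  by apply: imod_sum => i _; apply: (imod_scale modM).
exists [seq comb c | c in {ffun 'I_m -> F}]; split.
- rewrite size_image card_ffun card_ord; apply: leq_pexp2l => //.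
  by apply/card_gt0P; exists 0.
- by move=> _ /mapP[c _ ->]; apply: Mcomb.
move=> y My.
pose xy (i : 'I_m.+1) := oapp x y (unlift ord0 i).
have : ~ independent_mod xy by apply: maxm.
move/not_andP => [[]|]; first by move=> i; rewrite /xy; case: unlift.
move=> /existsNP[c /not_implyP[Mc nz]].
move: Mc; rewrite big_ord_recl {1}/xy unlift_none /=.
under eq_bigr do rewrite /xy liftK /=; move=> Mc.
have c0 : c ord0 != 0.
  apply/eqP => c0; apply: nz => i; case: (unliftP ord0 i) => [j|] -> //.
  apply: (indx (fun j => c (lift ord0 j))).
  by move: Mc; rewrite c0 rmorph0 mul0r add0r.
have ic0 : iota (c ord0) != 0 by rewrite fmorph_eq0.
pose d := [ffun i => - (c ord0)^-1 * c (lift ord0 i)].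
exists (comb d); first by apply: map_f; rewrite mem_enum.
rewrite (_ : _ * _ = iota (c ord0)^-1 *
  (s * (iota (c ord0) * y + \sum_i iota (c (lift ord0 i)) * x i))).
  exact: (imod_scale modM).
rewrite [RHS]mulrCA; congr (s * _).
rewrite mulrDr mulrA -rmorphM mulVf // rmorph1 mul1r; congr (y + _).
rewrite mulr_sumr /comb -sumrN; apply: eq_bigr => i _.
by rewrite ffunE mulNr rmorphN mulNr opprK rmorphM mulrA.
Qed.

End InverseModuleTheory.

Lemma pigeonhole (R : seq K) (Q : nat -> K -> Prop) :
    (forall i, exists2 r, r \in R & Q i r) ->
  exists i j r, [/\ (i < j)%N, (j <= size R)%N, Q i r & Q j r].
Proof.
move=> QR; pose r i := projT1 (cid2 (QR i)).
have rR i : r i \in R by rewrite /r; case: cid2.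
have Qr i : Q i (r i) by rewrite /r; case: cid2.
have ltr (i : 'I_(size R).+1) : (index (r i) R < size R)%N by rewrite index_mem.
pose f i := Ordinal (ltr i).
have : ~~ injectiveb f.
  apply/negP => /injectiveP /leq_card; rewrite !card_ord ltnn //.
move=> /injectivePn[i [j neq_ij /(congr1 val) /= eqf]].
have rij : r i = r j.
  by rewrite -[r i](nth_index 0 (rR i)) eqf nth_index.
have [ltij|ltji|eqij] := ltngtP i j.
- by exists i, j, (r i); split=> //; [rewrite -ltnS | rewrite rij].
- by exists j, i, (r i); split=> //; [rewrite -ltnS | rewrite rij].
by case/eqP: neq_ij; apply: val_inj.
Qed.

Lemma avoiding_neq0 V : valuation_ring iota V -> ~ V s -> s != 0.
Proof.
by move=> [algV _] Vs; apply/eqP => s0; apply: Vs; rewrite s0; apply: subalg0 algV.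
Qed.

Definition nonunits V : set K := [set x | x = 0 \/ ~ V x^-1].

Section ValuationRingTheory.
Variables (V : set K) (valV : valuation_ring iota V) (Vs : ~ V s).
Let algV : subalgebra iota V. Proof. exact: valring_subalg. Qed.
Let s0 : s != 0. Proof. exact: avoiding_neq0 Vs. Qed.
Let Vtot := valring_total valV.
Local Notation m := (nonunits V).

Lemma valring_inv : V s^-1. Proof. by case: (Vtot s). Qed.

Lemma valring_imod : inverse_module V.
Proof.
split=> [|x y|a x Vx|x Vx]; [exact: subalg0 algV|exact: (subalg_sub algV)| |].
  by apply: (subalg_mul algV) => //; apply: (subalg_const algV).
by apply: (subalg_mul algV) => //; apply: valring_inv.
Qed.

Lemma nonunits_sub x : m x -> V x.
Proof. by case=> [->|]; [apply: subalg0 algV | case: (Vtot x)]. Qed.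

Lemma nonunits_mul x y : m x -> V y -> m (x * y).
Proof.
have [->|x0] := eqVneq x 0; first by rewrite mul0r; left.
have [->|y0] := eqVneq y 0; first by rewrite mulr0; left.
case=> [/eqP|mx Vy]; first by rewrite (negPf x0).
right=> Vxy; apply: mx; rewrite (_ : x^-1 = y * (x * y)^-1).
  exact: (subalg_mul algV).
by field; rewrite x0 y0.
Qed.

Lemma nonunits_opp x : m x -> m (- x).
Proof.
move=> mx; rewrite -mulrN1; apply: nonunits_mul => //.
by apply: (subalg_opp algV); apply: subalg1 algV.
Qed.

Lemma nonunits_add x y : m x -> m y -> m (x + y).
Proof.
wlog Vxy : x y / V (x / y) => [wl mx my|mx my].
  have [Vxy|] := Vtot (x / y); first exact: wl.
  by rewrite invf_div addrC => Vyx; apply: wl.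
have [->|y0] := eqVneq y 0; first by rewrite addr0.
rewrite (_ : x + y = y * (x / y + 1)); last by field.
by apply: nonunits_mul => //; apply: (subalg_add algV) => //; apply: subalg1 algV.
Qed.

Lemma nonunits_sum (I : Type) (r : seq I) (P : pred I) (E : I -> K) :
  (forall i, P i -> m (E i)) -> m (\sum_(i <- r | P i) E i).
Proof. by apply: (big_ind m) => [|x y mx my]; [left|apply: nonunits_add]. Qed.

Lemma nonunits1 : ~ m 1.
Proof.
case=> [/eqP|]; first by rewrite oner_eq0.
by apply; rewrite invr1; apply: subalg1 algV.
Qed.

Lemma unit_inv x : ~ m x -> V x^-1.
Proof. by move=> mx; apply: contrapT => Vx; apply: mx; right. Qed.

Lemma unit_neq0 x : ~ m x -> x != 0.
Proof. by move=> mx; apply/eqP => x0; apply: mx; left. Qed.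

Lemma nonunits_pole x : V (s * x) -> m x.
Proof.
move=> Vx; rewrite -[x](mulKf s0); apply: nonunits_mul => //.
by right; rewrite invrK.
Qed.

Lemma unit_1D x : m x -> ~ m (1 + x).
Proof.
move=> mx m1; apply: nonunits1; rewrite -[1](addrK x).
by apply: nonunits_add => //; apply: nonunits_opp.
Qed.

(** Divisibility in V is total, so that one among 1/s and the finitely many
  nonunit residues divides the others, and then every nonunit. *)
Lemma uniformizer : exists w, [/\ w != 0, m w & forall x, m x -> V (x / w)].
Proof.
have [R [_ RV resV]] := residues valring_imod s0.
pose L := s^-1 :: [seq r <- R | `[< m r >] && (r != 0)].
have L0 x : x \in L -> m x /\ x != 0.
  rewrite inE mem_filter => /predU1P[->|/andP[/andP[/asboolP mx x0] _] //].
  by rewrite invr_eq0; split=> //; right; rewrite invrK.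
have V1 x : x != 0 -> V (x / x) by move=> x0; rewrite divff //; apply: subalg1 algV.
have Vdiv x y z : y != 0 -> V (x / y) -> V (y / z) -> V (x / z).
  by move=> y0 Vxy Vyz; rewrite -[x](divfK y0) -[_ / z]mulrA; apply: (subalg_mul algV).
have minL L' : forall a, a != 0 -> (forall x, x \in L' -> x != 0) ->
    exists2 w, w \in a :: L' & forall x, x \in a :: L' -> V (x / w).
  elim: L' => [|y L' IH] a a0 nz.
    by exists a; rewrite ?inE ?eqxx // => x; rewrite inE => /eqP ->; apply: V1.
  have y0 : y != 0 by apply: nz; rewrite inE eqxx.
  have nz' x : x \in L' -> x != 0 by move=> xL; apply: nz; rewrite inE xL orbT.
  have [b [b0 ab Va Vy]] : exists b,
      [/\ b != 0, b \in [:: a; y], V (a / b) & V (y / b)].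
    have [Vay|] := Vtot (a / y); first by exists y; rewrite !inE eqxx orbT; split; auto.
    by rewrite invf_div => Vya; exists a; rewrite !inE eqxx; split; auto.
  have [w wL Vw] := IH b b0 nz'; have Vb : V (b / w) by apply: Vw; rewrite inE eqxx.
  exists w.
    move: wL ab; rewrite !inE => /predU1P[->|->]; last by rewrite !orbT.
    by case/orP => ->; rewrite ?orbT.
  move=> x; rewrite !inE => /predU1P[->|/predU1P[->|xL]]; first exact: Vdiv Va Vb.
    exact: Vdiv Vy Vb.
  by apply: Vw; rewrite inE xL orbT.
have [|x xL|w wL divw] := minL [seq r <- R | `[< m r >] && (r != 0)] s^-1.
- by rewrite invr_eq0.
- by have [] := L0 x; rewrite // inE xL orbT.
have [mw w0] := L0 w wL; exists w; split=> // x mx.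
have [r rR Vr] := resV x (nonunits_sub mx).
rewrite (_ : x / w = s * (x - r) * (s^-1 / w) + r / w); last by field; rewrite w0 s0.
apply: (subalg_add algV).
  by apply: (subalg_mul algV) => //; apply: divw; rewrite inE eqxx.
have [->|r0] := eqVneq r 0; first by rewrite mul0r; apply: subalg0 algV.
apply: divw; rewrite inE mem_filter rR r0 !andbT; apply/orP; right; apply/asboolP.
rewrite (_ : r = x + - (x - r)); last by ring.
by apply: nonunits_add => //; apply: nonunits_opp; apply: nonunits_pole.
Qed.

Lemma unit_evalp q : q != 0 -> ~ m (ev q).
Proof.
move=> q0 mq; have [n szq] : exists n, size q = n.+1.
  by exists (size q).-1; rewrite prednK // lt0n size_poly_eq0.
have := imod_leading valring_imod s0 (eq_leq szq) (subalg1 algV).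
rewrite !mulr1 => /nonunits_pole mlead.
have m1 : m (s^-1 ^+ n * ev q).
  rewrite mulrC; apply: nonunits_mul => //; apply: (subalg_exp algV).
  exact: valring_inv.
have qn : q`_n != 0 by rewrite -[n]/(n.+1.-1) -szq -lead_coefE lead_coef_eq0.
apply: nonunits1; have -> : 1 = iota q`_n * iota (q`_n)^-1.
  by rewrite -rmorphM divff ?rmorph1.
apply: nonunits_mul; last exact: (subalg_const algV).
rewrite -[iota _](subKr (s^-1 ^+ n * ev q)).
by apply: nonunits_add => //; apply: nonunits_opp.
Qed.

(** If the pole of y dominated those of all powers of s, the top term of an
  algebraic equation of y over F[s] would dominate the others. *)
Lemma archimedean y : exists n, V (s^-1 ^+ n * y).
Proof.
apply: contrapT => /forallNP noV.
have y0 : y != 0.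
  apply/eqP => y0; apply: (noV 0%N); rewrite y0 mulr0; exact: subalg0 algV.
have mV n : m (s ^+ n / y).
  by right; rewrite invf_div mulrC -exprVn; apply: noV.
have [q [[j qj] sum0]] := ev_dependent (fun i => y ^+ i).
have [k qk ltk] := @arg_maxnP _ j (fun i => q i != 0) val qj.
apply: (unit_evalp qk); pose E i := ev (q i) * y ^+ i / y ^+ k.
have : \sum_i E i = 0 by rewrite -mulr_suml sum0 mul0r.
rewrite (bigD1 k) //= {1}/E mulfK ?expf_neq0 // => /eqP.
rewrite addr_eq0 => /eqP ->; apply: nonunits_opp; apply: nonunits_sum => i neq_ik.
have [qi0|qi0] := eqVneq (q i) 0; first by rewrite /E qi0 rmorph0 !mul0r; left.
have ltik : (i < k)%N.
  by rewrite ltn_neqAle; apply/andP; split; [exact: neq_ik | exact: ltk].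
have -> : E i = ev (q i) / y * y^-1 ^+ (k - i).-1.
  rewrite /E -!mulrA; congr (_ * _); rewrite -exprS prednK ?subn_gt0 // exprVn.
  have yi0 : y ^+ i != 0 by rewrite expf_neq0.
  have yki0 : y ^+ (k - i) != 0 by rewrite expf_neq0.
  have -> : y ^+ k = y ^+ i * y ^+ (k - i) by rewrite -exprD subnKC // ltnW.
  by field; rewrite yi0 yki0.
apply: nonunits_mul; last first.
  apply: (subalg_exp algV); rewrite -[y^-1]mul1r -(expr0 s).
  exact: nonunits_sub (mV 0%N).
rewrite (evalp_sum _ _ (leqnn _)) mulr_suml; apply: nonunits_sum => l _.
rewrite -mulrA mulrC; apply: nonunits_mul => //; exact: (subalg_const algV).
Qed.

End ValuationRingTheory.

End AvoidingPlaces.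

(** * Discrete valuations with finite residue field *)

Section DiscreteValuations.
Variable K : fieldType.

(** The value of a valuation at 0 is arbitrary, whence the separate case. *)
Definition at_least (v : K -> int) (n : int) (x : K) : bool :=
  (x == 0) || (n <= v x).

Record dvaluation := DValuation {
  dval :> K -> int;
  dvalM : forall x y, x != 0 -> y != 0 -> dval (x * y) = dval x + dval y;
  at_leastD : forall n x y,
    at_least dval n x -> at_least dval n y -> at_least dval n (x + y);
  dval_uniformizer : exists2 w, w != 0 & dval w = 1;
  dval_residues : exists R : seq K, forall x, at_least dval 0 x ->
    exists2 r, r \in R & at_least dval 1 (x - r) }.

Variable v : dvaluation.

Lemma dval1 : v 1 = 0.
Proof.
by apply: (@addrI _ (v 1)); rewrite -dvalM ?oner_neq0 // mulr1 addr0.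
Qed.

Lemma dvalV x : x != 0 -> v x^-1 = - v x.
Proof.
move=> x0; apply: (@addrI _ (v x)).
by rewrite subrr -dvalM ?invr_eq0 // divff ?dval1.
Qed.

Lemma dvalN x : v (- x) = v x.
Proof.
have [->|x0] := eqVneq x 0; first by rewrite oppr0.
have N10 : -1 != 0 :> K by rewrite oppr_eq0 oner_neq0.
have := dvalM v N10 N10; rewrite mulrNN mulr1 dval1 => vN1.
by rewrite -mulN1r dvalM //; lia.
Qed.

Lemma dvalX x n : x != 0 -> v (x ^+ n) = v x *+ n.
Proof.
move=> x0; elim: n => [|n IHn]; first by rewrite dval1.
by rewrite exprS dvalM ?expf_neq0 // IHn mulrS.
Qed.

Lemma dvalXz x n : x != 0 -> v (x ^ n) = v x * n.
Proof.
move=> x0; case: n => n; first by rewrite -exprnP dvalX // -mulr_natr natz.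
rewrite NegzE -exprnN dvalV ?expf_neq0 //.
by rewrite dvalX // mulrN -mulr_natr natz.
Qed.

Lemma at_least0 n : at_least v n 0. Proof. by rewrite /at_least eqxx. Qed.

Lemma at_leastN n x : at_least v n (- x) = at_least v n x.
Proof. by rewrite /at_least oppr_eq0 dvalN. Qed.

Lemma at_leastB n x y :
  at_least v n x -> at_least v n y -> at_least v n (x - y).
Proof. by move=> vx vy; apply: at_leastD => //; rewrite at_leastN. Qed.

Lemma at_leastM m n x y :
  at_least v m x -> at_least v n y -> at_least v (m + n) (x * y).
Proof.
rewrite /at_least mulf_eq0; have [//|x0] := eqVneq x 0.
have [//|y0] := eqVneq y 0; rewrite /= dvalM //; exact: lerD.
Qed.

Lemma at_least_sum n (I : Type) (r : seq I) (P : pred I) (E : I -> K) :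
  (forall i, P i -> at_least v n (E i)) ->
  at_least v n (\sum_(i <- r | P i) E i).
Proof.
apply: (big_ind (fun x => at_least v n x)) => [|x y]; first exact: at_least0.
exact: at_leastD.
Qed.

Lemma at_leastW m n x : m <= n -> at_least v n x -> at_least v m x.
Proof. by rewrite /at_least => le_mn /orP[->//|/(le_trans le_mn)->]; rewrite orbT. Qed.

End DiscreteValuations.

(** * The places that avoid s *)

Section Places.
Variables (F : finFieldType) (K : fieldType) (iota : {rmorphism F -> K}).
Variables (s : K) (D : nat).
Implicit Types (V : set K) (x y z : K).

Local Notation ev := (evalp iota s).

Hypothesis ev_dependent : forall x : 'I_D.+1 -> K,
  exists q : 'I_D.+1 -> {poly F},
    (exists i, q i != 0) /\ \sum_i ev (q i) * x i = 0.

Section OnePlace.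
Variables (V : set K) (valV : valuation_ring iota V) (Vs : ~ V s).
Let algV : subalgebra iota V. Proof. exact: valring_subalg. Qed.
Let s0 : s != 0. Proof. exact: avoiding_neq0 valV Vs. Qed.
Let Vtot := valring_total valV.
Local Notation m := (nonunits V).

Section Uniformizer.
Variables (w : K) (w0 : w != 0) (mw : m w).
Hypothesis divw : forall x, m x -> V (x / w).

Lemma valring_exprz n : V (w ^ n) <-> 0 <= n.
Proof.
have Vw : V w := nonunits_sub valV mw.
split; last first.
  by case: n => // n _; rewrite -exprnP; apply: (subalg_exp algV).
apply: contraPP => /negP; rewrite -ltNge => n0 Vn.
have : V w^-1.
  rewrite (_ : w^-1 = w ^ n * w ^ (- n - 1)).
    have [k ->] : exists k : nat, - n - 1 = k by exists `|- n - 1|%N; lia.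
    by apply: (subalg_mul algV) => //; apply: (subalg_exp algV).
  by rewrite -expfzDr // addrA addrN add0r exprN1.
by case: mw => // w00; move: w0; rewrite w00 eqxx.
Qed.

(** Two powers of w are congruent modulo 1/s; their difference is the power of
  smaller exponent times a unit 1 - w^n, so that this power is a multiple of
  1/s. *)
Lemma power_below_pole : exists k, V (s * w ^+ k).
Proof.
have [R [_ RV resV]] := residues ev_dependent (valring_imod valV Vs) s0.
have Vw : V w := nonunits_sub valV mw.
have VX n : V (w ^+ n) by apply: (subalg_exp algV).
have [i [j [r [ltij _ Vi Vj]]]] := pigeonhole (fun i => resV _ (VX i)).
exists i.
have Vij : V (s * (w ^+ i - w ^+ j)).
  rewrite (_ : _ * _ = s * (w ^+ i - r) - s * (w ^+ j - r)); last by ring.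
  exact: (subalg_sub algV).
have wji : ~ m (1 - w ^+ (j - i)).
  apply: (unit_1D valV); apply: (nonunits_opp valV).
  rewrite -[(j - i)%N]prednK ?subn_gt0 // exprS.
  by apply: (nonunits_mul valV).
have wji0 := unit_neq0 wji.
rewrite (_ : s * _ = s * (w ^+ i - w ^+ j) * (1 - w ^+ (j - i))^-1).
  by apply: (subalg_mul algV) => //; apply: (unit_inv wji).
rewrite (_ : w ^+ j = w ^+ i * w ^+ (j - i)); last by rewrite -exprD subnKC 1?ltnW.
by field.
Qed.

(** An element divisible by all powers of w would be divisible by all powers of
  1/s, against the archimedean property. *)
Lemma unit_part_integral x : V x -> x != 0 ->
  exists n : nat, V (x / w ^+ n) /\ V (w ^+ n / x).
Proof.
move=> Vx x0; have [k Vk] := power_below_pole.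
have [N VN] := archimedean ev_dependent valV Vs x^-1.
have noV : ~ V (x / w ^+ (k * N).+1).
  move=> Vw; case: mw => [w00|]; first by move: w0; rewrite w00 eqxx.
  apply; rewrite (_ : w^-1 = (s^-1 ^+ N * x^-1) * ((s * w ^+ k) ^+ N) *
     (x / w ^+ (k * N).+1)).
    apply: (subalg_mul algV) => //; apply: (subalg_mul algV) => //.
    exact: (subalg_exp algV).
  have wkN : w ^+ (k * N) != 0 by rewrite expf_neq0.
  have sN : s ^+ N != 0 by rewrite expf_neq0.
  rewrite exprMn -exprM exprVn exprS.
  by field; rewrite wkN sN w0 x0.
have [n [Vn noVn]] : exists n, V (x / w ^+ n) /\ ~ V (x / w ^+ n.+1).
  apply: contrapT => no; apply: noV.
  elim: (k * N).+1 => [|n IHn]; first by rewrite divr1.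
  by apply: contrapT => nV; apply: no; exists n.
exists n; split=> //; rewrite -invf_div; apply: unit_inv => mx.
by apply: noVn; rewrite exprS invfM mulrCA mulrC; apply: divw.
Qed.

Lemma unit_part x : x != 0 -> exists n : int, V (x / w ^ n) /\ V (w ^ n / x).
Proof.
move=> x0; have [Vx|Vx] := Vtot x.
  by have [n] := unit_part_integral Vx x0; exists n.
have [|n [V1 V2]] := unit_part_integral Vx; first by rewrite invr_eq0.
exists (- n%:Z); rewrite -invr_expz invrK -exprnP.
split; first by rewrite -[x]invrK mulrC.
by rewrite -invfM mulrC invfM.
Qed.

Definition exponent x : int := xget 0 [set n | V (x / w ^ n) /\ V (w ^ n / x)].

Lemma exponentP x : x != 0 -> V (x / w ^ exponent x) /\ V (w ^ exponent x / x).
Proof. by move=> /unit_part xn; apply: (xgetPex 0 xn). Qed.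

Lemma exponent_ge x n : x != 0 -> V (x / w ^ n) <-> n <= exponent x.
Proof.
move=> x0; have [V1 V2] := exponentP x0.
have wn k : w ^ k != 0 by rewrite expfz_neq0.
rewrite -subr_ge0 -valring_exprz expfzDr // -invr_expz; split=> Vx.
  rewrite (_ : _ * _ = (x / w ^ n) * (w ^ exponent x / x)).
    exact: (subalg_mul algV).
  by field; rewrite x0 wn.
rewrite (_ : x / w ^ n = (x / w ^ exponent x) * (w ^ exponent x / w ^ n)).
  exact: (subalg_mul algV).
by field; rewrite !wn.
Qed.

Lemma at_least_exponent n x : at_least exponent n x <-> V (x / w ^ n).
Proof.
rewrite /at_least; have [->|x0] := eqVneq x 0.
  by split=> // _; rewrite mul0r; apply: subalg0 algV.
by rewrite exponent_ge.
Qed.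

Lemma exponent_eq x n : x != 0 -> V (x / w ^ n) -> V (w ^ n / x) -> exponent x = n.
Proof.
move=> x0 Vx Vx'; apply/eqP; rewrite eq_le; apply/andP; split; last exact/exponent_ge.
have [V1 V2] := exponentP x0; have wn k : w ^ k != 0 by rewrite expfz_neq0.
rewrite -subr_ge0 -valring_exprz expfzDr // -invr_expz.
rewrite (_ : _ / _ = (x / w ^ exponent x) * (w ^ n / x)).
  exact: (subalg_mul algV).
by field; rewrite x0 wn.
Qed.

Lemma exponent1_nonunit x : at_least exponent 1 x <-> m x.
Proof.
rewrite at_least_exponent expr1z; split; last exact: divw.
by move=> Vx; rewrite -(divfK w0 x) mulrC; apply: (nonunits_mul valV).
Qed.

End Uniformizer.

Lemma valuation_ring_discrete : exists v : dvaluation K,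
  forall x, (at_least v 0 x <-> V x) /\ (at_least v 1 x <-> m x).
Proof.
have [w [w0 mw divw]] := uniformizer ev_dependent valV Vs.
have wn k : w ^ k != 0 by rewrite expfz_neq0.
pose o := exponent w.
have oP := at_least_exponent w0 mw divw.
have oM x y : x != 0 -> y != 0 -> o (x * y) = o x + o y.
  move=> x0 y0; have [x1 x2] := exponentP w0 mw divw x0.
  have [y1 y2] := exponentP w0 mw divw y0.
  rewrite -/o in x1 x2 y1 y2.
  apply: exponent_eq; rewrite ?mulf_neq0 // expfzDr //.
    rewrite (_ : _ / _ = (x / w ^ o x) * (y / w ^ o y)); last by field; rewrite !wn.
    exact: (subalg_mul algV).
  rewrite (_ : _ / _ = (w ^ o x / x) * (w ^ o y / y)); last by field; rewrite x0 y0.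
  exact: (subalg_mul algV).
have oD n x y : at_least o n x -> at_least o n y -> at_least o n (x + y).
  by move=> /oP Vx /oP Vy; apply/oP; rewrite mulrDl; apply: (subalg_add algV).
have o1 : exists2 w, w != 0 & o w = 1.
  exists w => //; apply: exponent_eq; rewrite // expr1z divff //;
    exact: subalg1 algV.
have V0 x : at_least o 0 x <-> V x by rewrite oP expr0z divr1.
have m1 x : at_least o 1 x <-> m x by apply: exponent1_nonunit.
have oR : exists R : seq K, forall x, at_least o 0 x ->
    exists2 r, r \in R & at_least o 1 (x - r).
  have [R [_ _ resV]] := residues ev_dependent (valring_imod valV Vs) s0.
  exists R => x /V0 /resV [r rR Vr]; exists r => //.
  by apply/m1; apply: (nonunits_pole valV Vs).
by exists (DValuation oM oD o1 oR).
Qed.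

(** The residue field has at most N = |F|^D elements, so its nonzero elements
  satisfy X^(N!) = 1; the exponent is the same at all places. *)
Lemma nonunits_fermat x : V x -> m (x ^+ ((#|F| ^ D)`!).+1 - x).
Proof.
move=> Vx; have [mx|nmx] := pselect (m x).
  rewrite exprS -[X in _ - X]mulr1 -mulrBr; apply: (nonunits_mul valV) => //.
  apply: (subalg_sub algV); last exact: subalg1 algV.
  exact: (subalg_exp algV).
have [R [szR RV resV]] := residues ev_dependent (valring_imod valV Vs) s0.
have VX n : V (x ^+ n) by apply: (subalg_exp algV).
have [i [j [r [ltij lej Vi Vj]]]] := pigeonhole (fun i => resV _ (VX i)).
have x0 := unit_neq0 nmx.
have mij : m (x ^+ (j - i) - 1).
  have xi0 : x ^+ i != 0 by rewrite expf_neq0.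
  rewrite (_ : _ - _ = ((x ^+ j - r) + - (x ^+ i - r)) * x^-1 ^+ i).
    apply: (nonunits_mul valV); last first.
      by apply: (subalg_exp algV); apply: unit_inv.
    apply: (nonunits_add valV); first exact: (nonunits_pole valV Vs).
    by apply: (nonunits_opp valV); apply: (nonunits_pole valV Vs).
  rewrite -{2}(subnKC (ltnW ltij)) exprD exprVn.
  by field.
have /dvdnP[k ->] : (j - i %| (#|F| ^ D)`!)%N.
  apply: dvdn_fact; rewrite subn_gt0 ltij.
  by rewrite (leq_trans (leq_subr _ _)) ?(leq_trans lej).
rewrite exprS -[X in _ - X]mulr1 -mulrBr mulrC mulnC exprM subrX1.
apply: (nonunits_mul valV) => //; apply: (nonunits_mul valV) => //.
apply: (subalg_sum algV) => l _; do 2!apply: (subalg_exp algV); exact: Vx.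
Qed.

End OnePlace.

Definition everywhere_integral : set K :=
  [set x | forall V, valuation_ring iota V -> ~ V s -> V x].

Lemma everywhere_integral_imod : inverse_module iota s everywhere_integral.
Proof.
split=> [V valV _|x y Bx By V valV Vs|a x Bx V valV Vs|x Bx V valV Vs].
- exact: subalg0 (valring_subalg valV).
- by apply: (subalg_sub (valring_subalg valV)); [apply: Bx | apply: By].
- by apply: (imod_scale (valring_imod valV Vs)); apply: Bx.
- by apply: (imod_div (valring_imod valV Vs)); apply: Bx.
Qed.

(** The polynomial X^M - X + 1 of nonunits_fermat has no root in any residue
  field, so the inverse of its value at x is integral everywhere, and vanishes
  at V exactly when x has a pole there. *)
Lemma pole_detector x : exists2 y, everywhere_integral y &
  forall V, valuation_ring iota V -> ~ V s -> nonunits V y <-> ~ V x.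
Proof.
pose N := (#|F| ^ D)`!; pose y := x ^+ N.+1 - x + 1.
have yV V : valuation_ring iota V -> ~ V s -> V x -> ~ nonunits V y /\ V y^-1.
  move=> valV Vs Vx.
  have ny : ~ nonunits V y.
    by rewrite /y addrC; apply: (unit_1D valV); apply: nonunits_fermat.
  by split=> //; apply: (unit_inv ny).
have yM V : valuation_ring iota V -> ~ V s -> ~ V x -> nonunits V y^-1.
  move=> valV Vs Vx; have algV := valring_subalg valV.
  have x0 : x != 0 by apply/eqP => x0; apply: Vx; rewrite x0; apply: subalg0 algV.
  have mx : nonunits V x^-1 by right; rewrite invrK.
  have Vx' := nonunits_sub valV mx.
  pose e := - x^-1 ^+ N + x^-1 ^+ N.+1.
  have me : nonunits V e.
    rewrite /e /N -[_`!]prednK ?fact_gt0 //.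
    apply: (nonunits_add valV); first apply: (nonunits_opp valV);
      rewrite exprS; apply: (nonunits_mul valV) => //; exact: (subalg_exp algV).
  have n1e := unit_1D valV me; have e0 := unit_neq0 n1e.
  have xN0 : x ^+ N != 0 by rewrite expf_neq0.
  rewrite (_ : y = x ^+ N.+1 * (1 + e)); last first.
    by rewrite /y /e !exprVn exprS; field; rewrite x0 xN0.
  rewrite invfM -exprVn exprS -mulrA; apply: (nonunits_mul valV) => //.
  apply: (subalg_mul algV); first exact: (subalg_exp algV).
  exact: (unit_inv n1e).
exists y^-1 => [V valV Vs|V valV Vs].
  have [Vx|Vx] := pselect (V x); first by have [] := yV V valV Vs Vx.
  exact: (nonunits_sub valV (yM V valV Vs Vx)).
split; last exact: yM.
move=> my Vx; have [ny _] := yV V valV Vs Vx.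
case: my => [/eqP|]; first by rewrite invr_eq0; apply/negP/(unit_neq0 ny).
rewrite invrK; apply; rewrite /y; have algV := valring_subalg valV.
apply: (subalg_add algV); last exact: subalg1 algV.
by apply: (subalg_sub algV) => //; apply: (subalg_exp algV).
Qed.

Hypothesis s_trans : ~ integralOver iota s.

Lemma everywhere_vanishing x : integralOver ev x ->
  (forall V, valuation_ring iota V -> ~ V s -> nonunits V x) -> x = 0.
Proof.
move=> intx Nx; apply/eqP; apply: contraPT isT => x0 _.
have [V [valV Vs Vx]] := nonzero_integral_valuation s_trans x0 intx.
by case: (Nx V valV Vs) => // /eqP; apply/negP.
Qed.

(** Two powers of z are congruent modulo 1/s at all places; their difference is
  integral over F[s], so that it vanishes, and z is zero or a root of unity. *)
Lemma everywhere_integral_nonunit z V :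
  integralOver ev z -> everywhere_integral z ->
  valuation_ring iota V -> ~ V s -> nonunits V z -> z = 0.
Proof.
move=> intz Bz valV Vs Vz; have s0 := avoiding_neq0 valV Vs.
have modB := everywhere_integral_imod.
have [R [_ _ resB]] := residues ev_dependent modB s0.
have BX n : everywhere_integral (z ^+ n).
  by move=> W valW Ws; apply: (subalg_exp (valring_subalg valW)); apply: Bz.
have [i [j [r [ltij _ Bi Bj]]]] := pigeonhole (fun i => resB _ (BX i)).
have intX n : integralOver ev (z ^+ n).
  elim: n => [|n IHn]; first exact: integral1.
  by rewrite exprS; apply: integral_mul.
have /eqP : z ^+ i - z ^+ j = 0.
  apply: everywhere_vanishing; first exact: integral_sub.
  move=> W valW Ws; rewrite (_ : _ - _ = (z ^+ i - r) + - (z ^+ j - r)); last by ring.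
  apply: (nonunits_add valW); first exact: (nonunits_pole valW Ws (Bi W valW Ws)).
  by apply: (nonunits_opp valW); apply: (nonunits_pole valW Ws (Bj W valW Ws)).
rewrite -(subnKC (ltnW ltij)) exprD -{1}[z ^+ i]mulr1 -mulrBr mulf_eq0.
case/orP => [|]; first by rewrite expf_eq0 => /andP[_ /eqP].
rewrite subr_eq0 eq_sym => /eqP zji; case: (nonunits1 valV).
rewrite -zji -[(j - i)%N]prednK ?subn_gt0 // exprS.
apply: (nonunits_mul valV) => //; apply: (subalg_exp (valring_subalg valV)).
exact: Bz.
Qed.

(** A place is determined by the everywhere integral elements that are nonunits
  there (pole_detector), hence by its nonunits among finitely many residues of
  these elements modulo 1/s. *)
Theorem finitely_many_places : exists (I : finType) (v : I -> dvaluation K) (i0 : I),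
  forall z, integralOver ev z -> (forall i, at_least (v i) 0 z) ->
    at_least (v i0) 1 z -> z = 0.
Proof.
have [V0 [valV0 V0s _]] : exists V, [/\ valuation_ring iota V, ~ V s & V 1^-1].
  apply: nonzero_integral_valuation; rewrite ?oner_neq0 //; exact: integral1.
have s0 := avoiding_neq0 valV0 V0s.
have [R [_ RB resB]] := residues ev_dependent everywhere_integral_imod s0.
pose code V := [ffun i : 'I_(size R) => `[< nonunits V R`_i >]].
have code_sub V W : valuation_ring iota V -> ~ V s -> valuation_ring iota W ->
    ~ W s -> code V = code W -> V `<=` W.
  move=> valV Vs valW Ws eqVW x Vx; apply: contrapT => Wx.
  have [y By yP] := pole_detector x.
  have [r rR Br] := resB y By.
  have my U : valuation_ring iota U -> ~ U s -> nonunits U y <-> nonunits U r.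
    move=> valU Us.
    have mUr : nonunits U (y - r) by apply: (nonunits_pole valU Us); apply: Br.
    split=> [my|mr].
      rewrite (_ : r = y + - (y - r)); last by ring.
      by apply: (nonunits_add valU) => //; apply: (nonunits_opp valU).
    by rewrite -(subrK r y); apply: (nonunits_add valU).
  have /ffunP/(_ (Ordinal (etrans (index_mem r R) rR))) := eqVW.
  rewrite !ffunE /= nth_index // => eqVWr; have mVW := asbool_eq_equiv eqVWr.
  have Wr : nonunits W r by apply/(my W valW Ws)/(yP W valW Ws).
  have Vr : nonunits V r := mVW.2 Wr.
  by have /(yP V valV Vs) := (my V valV Vs).2 Vr.
have vP V : valuation_ring iota V -> ~ V s -> exists v : dvaluation K,
    forall x, (at_least v 0 x <-> V x) /\ (at_least v 1 x <-> nonunits V x).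
  exact: valuation_ring_discrete.
pose I : finType := {ffun 'I_(size R) -> bool}.
have /choice[V_ V_P] : forall c : I, exists W, [/\ valuation_ring iota W, ~ W s &
    forall V, valuation_ring iota V -> ~ V s -> code V = c -> V = W].
  move=> c.
  have [[V [valV Vs cV]]|noV] := pselect (exists V,
      [/\ valuation_ring iota V, ~ V s & code V = c]); last first.
    by exists V0; split=> // V valV Vs cV; case: noV; exists V.
  exists V; split=> // W valW Ws cW.
  by apply/seteqP; split; apply: code_sub; rewrite // cW cV.
have /choice[v v_P] : forall c : I, exists v : dvaluation K, forall x,
    (at_least v 0 x <-> V_ c x) /\ (at_least v 1 x <-> nonunits (V_ c) x).
  by move=> c; have [valV Vs _] := V_P c; apply: vP.
exists I, v, (code V0) => z intz vz vz0.
have [valV Vs _] := V_P (code V0).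
apply: (everywhere_integral_nonunit intz _ valV Vs); last exact/(v_P _ z).2.
move=> W valW Ws; have [_ _ VW] := V_P (code W).
by rewrite (VW W valW Ws erefl); apply/(v_P _ z).1.
Qed.

End Places.

(** * Noether normalization of function fields *)

Lemma dependent_rows (R : idomainType) (N : nat) (r : 'I_N.+1 -> 'I_N -> R) :
  exists q : 'I_N.+1 -> R, (exists i, q i != 0) /\
    forall j, \sum_i q i * r i j = 0.
Proof.
pose M := \matrix_(i, k) oapp (r i) 0 (unlift ord0 k).
have /eqP/det0P[q q0 qM] : \det M = 0.
  rewrite (expand_det_col M ord0) big1 // => i _.
  by rewrite mxE unlift_none mul0r.
exists (q 0); split.
  apply/existsP; apply: contraNT q0; rewrite negb_exists => /forallP qi.
  by apply/eqP/rowP => i; rewrite mxE; apply/eqP; rewrite -[_ == _]negbK.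
move=> j; have /rowP/(_ (lift ord0 j)) := qM.
rewrite !mxE => qMj; rewrite -[RHS]qMj; apply: eq_bigr => i _.
by rewrite mxE liftK.
Qed.

Lemma fraction_repr (R : idomainType) (c : {fraction R}) :
  exists a b, b != 0 /\ tofrac b * c = tofrac a.
Proof.
elim/quotW: c => x; exists x.1, x.2; split; first exact: denom_ratioP.
rewrite -[LHS]/(FracField.mul _ _) !piE; apply/eqmodP => /=.
by rewrite FracField.equivfE /FracField.mulf !numden_Ratio ?oner_eq0 ?mul1r ?mulr1 //
  ?denom_ratioP // mulrC.
Qed.

Section FunctionField.
Variables (F : finFieldType) (K : fieldExtType {fraction {poly F}}).

Definition poly_embed : {poly F} -> K := in_alg K \o @tofrac _.
HB.instance Definition _ := GRing.RMorphism.on poly_embed.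
Definition const_embed : F -> K := poly_embed \o polyC.
HB.instance Definition _ := GRing.RMorphism.on const_embed.

Local Notation t := (poly_embed 'X).
Local Notation d := (\dim {:K}).

Lemma poly_embed_eq0 q : (poly_embed q == 0) = (q == 0).
Proof. by rewrite /poly_embed /= scaler_eq0 oner_eq0 orbF tofrac_eq0. Qed.

Lemma evalp_poly_embed q : evalp const_embed t q = poly_embed q.
Proof.
rewrite evalpE /const_embed map_poly_comp horner_map /=.
by rewrite -[X in poly_embed X]/(q \Po 'X) comp_polyXr.
Qed.

Lemma common_denominator (I : finType) (x : I -> K) :
  exists (e : {poly F}) (m : I -> 'I_d -> {poly F}), e != 0 /\
    forall i, poly_embed e * x i = \sum_j poly_embed (m i j) * (vbasis {:K})`_j.
Proof.
pose c (ij : I * 'I_d) := coord (vbasis {:K}) ij.2 (x ij.1).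
have /choice[a /choice[b ab]] := fun ij => fraction_repr (c ij).
pose e := \prod_ij b ij.
exists e, (fun i j => \prod_(ij | ij != (i, j)) b ij * a (i, j)).
split; first by apply/prodf_neq0 => ij _; have [] := ab ij.
move=> i; rewrite {1}(coord_vbasis (memvf (x i))) mulr_sumr; apply: eq_bigr => j _.
rewrite -[coord _ _ _]/(c (i, j)) /poly_embed /= !mulr_algl scalerA; congr (_ *: _).
rewrite /e (bigD1 (i, j)) //= mulrC !tofracM; have [_ <-] := ab (i, j).
by rewrite [LHS]mulrC -mulrA [LHS]mulrCA.
Qed.

Lemma poly_algebraic (x : K) :
  exists2 Q : {poly {poly F}}, Q != 0 & root (map_poly poly_embed Q) x.
Proof.
have [e [m [e0 em]]] := common_denominator (fun i : 'I_d.+1 => x ^+ i).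
have [q [[i qi] qm]] := dependent_rows m.
exists (\poly_(i < d.+1) q (inord i)).
  apply/eqP => /polyP/(_ i); rewrite coef_poly ltn_ord inord_val coef0.
  exact/eqP.
have pe0 : poly_embed e != 0 by rewrite poly_embed_eq0.
rewrite rootE (@horner_coef_wide _ d.+1); last first.
  exact: leq_trans (size_poly _ _) (size_poly _ _).
apply/eqP/(mulfI pe0); rewrite mulr0 mulr_sumr.
under eq_bigr => l _.
  rewrite coef_map coef_poly ltn_ord inord_val mulrCA em mulr_sumr.
  over.
rewrite exchange_big big1 //= => j _.
under eq_bigr => l _ do rewrite mulrA -rmorphM.
by rewrite -mulr_suml -rmorph_sum qm rmorph0 mul0r.
Qed.

(** An element is integral over any ring containing F[t] in which the leading
  coefficient of its equation is invertible; inverting c inverts all of these. *)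
Lemma common_leading_multiple (L : seq K) : exists2 c : {poly F}, c \is monic &
  forall x, x \in L -> exists (Q : {poly {poly F}}) (b : {poly F}),
    root (map_poly poly_embed Q) x /\ c = b * lead_coef Q.
Proof.
suff [c c0 cL] : exists2 c : {poly F}, c != 0 &
  forall x, x \in L -> exists (Q : {poly {poly F}}) (b : {poly F}),
    root (map_poly poly_embed Q) x /\ c = b * lead_coef Q.
  have lc0 : lead_coef c != 0 by rewrite lead_coef_eq0.
  exists ((lead_coef c)^-1 *: c); first by rewrite monicE lead_coefZ mulVf.
  move=> x /cL[Q [b [Qx ->]]]; exists Q, ((lead_coef (b * lead_coef Q))^-1 *: b).
  by rewrite scalerAl.
elim: L => [|y L [c c0 cL]]; first by exists 1; rewrite ?oner_neq0.
have [Q Q0 Qy] := poly_algebraic y.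
exists (c * lead_coef Q); first by rewrite mulf_neq0 ?lead_coef_eq0.
move=> x; rewrite inE => /predU1P[->|/cL[Q' [b [Q'x ->]]]]; first by exists Q, c.
by exists Q', (b * lead_coef Q); rewrite mulrAC.
Qed.

Section Normalization.
Variables (c : {poly F}) (mon_c : c \is monic).

(** The poles of s are those of t and the zeros of c: both t and 1/c(t) are
  integral over F[s]. *)
Definition normal_parameter : K := t + (poly_embed c)^-1.
Local Notation s := normal_parameter.
Local Notation ev := (evalp const_embed s).

(** The equation c(t) (t - s) + 1 = 0 of t over F[s]. *)
Definition parameter_poly : {poly {poly F}} :=
  map_poly polyC c * ('X - ('X)%:P) + 1.

Let c0 : poly_embed c != 0. Proof. by rewrite poly_embed_eq0 monic_neq0. Qed.

Lemma parameter_poly_monic : parameter_poly \is monic.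
Proof.
have mon : map_poly polyC c * ('X - ('X)%:P) \is monic.
  by rewrite monicMr ?monicXsubC ?monic_map.
apply/monicP; rewrite lead_coefDl ?(monicP mon) // size_poly1.
rewrite size_Mmonic ?monicXsubC ?monic_neq0 ?monic_map // size_XsubC addn2 ltnS.
by rewrite size_poly_gt0 monic_neq0 ?monic_map.
Qed.

Lemma parameter_poly_root : root (map_poly ev parameter_poly) t.
Proof.
rewrite rootE rmorphD rmorphM rmorphB rmorph1 /= map_polyX map_polyC /= evalpX.
rewrite -map_poly_comp !hornerE.
have -> : map_poly (ev \o polyC) c = map_poly const_embed c.
  by apply: eq_map_poly => a; rewrite /= evalpC.
rewrite -evalpE evalp_poly_embed /normal_parameter opprD addrA subrr add0r.
by rewrite mulrN divff // addNr.
Qed.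

Lemma integral_t : integralOver ev t.
Proof. by exists parameter_poly; rewrite ?parameter_poly_monic ?parameter_poly_root. Qed.

Lemma integral_const a : integralOver ev (const_embed a).
Proof. by rewrite -(evalpC const_embed s); apply: integral_id. Qed.

Lemma integral_poly_embed q : integralOver ev (poly_embed q).
Proof.
rewrite -evalp_poly_embed.
by apply: integral_evalp; [apply: integral_const | apply: integral_t].
Qed.

Lemma integral_inv_c : integralOver ev (poly_embed c)^-1.
Proof.
have -> : (poly_embed c)^-1 = s - t by rewrite /normal_parameter addrC addKr.
apply: integral_sub integral_t.
by have := integral_id (evalp const_embed s) 'X; rewrite /= evalpX.
Qed.

Lemma integral_leading (Q : {poly {poly F}}) b x :
  root (map_poly poly_embed Q) x -> c = b * lead_coef Q -> integralOver ev x.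
Proof.
move=> Qx cE; have l0 : poly_embed (lead_coef Q) != 0.
  by apply: contraNneq c0 => l0; rewrite cE rmorphM /= l0 mulr0.
have lV : (poly_embed (lead_coef Q))^-1 = poly_embed b * (poly_embed c)^-1.
  have b0 : poly_embed b != 0.
    by apply: contraNneq c0 => b0; rewrite cE rmorphM /= b0 mul0r.
  by rewrite cE rmorphM /= invfM mulrA divff ?mul1r.
pose P := (poly_embed (lead_coef Q))^-1 *: map_poly poly_embed Q.
have mon_P : P \is monic.
  by rewrite monicE lead_coefZ lead_coef_map_eq // mulVf.
apply: (integral_root_monic mon_P); first by rewrite rootE hornerZ (rootP Qx) mulr0.
apply/integral_poly => i; rewrite coefZ coef_map lV.
apply: integral_mul (integral_poly_embed _).
exact: integral_mul (integral_poly_embed _) integral_inv_c.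
Qed.

Lemma parameter_transcendental : ~ integralOver const_embed s.
Proof.
move=> ints; have [p mon_p] : integralOver const_embed t.
  apply: integral_trans integral_t => q; apply: integral_evalp ints q => a.
  exact: integral_id.
rewrite rootE -evalpE evalp_poly_embed poly_embed_eq0; apply/negP.
exact: monic_neq0.
Qed.

(** Euclidean division by the monic equation of t reduces F[t] to a finitely
  generated F[s]-module. *)
Lemma parameter_module q : exists r : 'I_(size parameter_poly) -> {poly F},
  poly_embed q = \sum_l ev (r l) * t ^+ l.
Proof.
pose U := map_poly polyC q; pose P := parameter_poly.
pose r := Pdiv.Ring.rmodp U P.
exists (fun l => r`_l).
have -> : poly_embed q = (map_poly ev U).[t].
  rewrite -evalp_poly_embed evalpE /U -map_poly_comp; congr _.[_].
  by apply: eq_map_poly => a; rewrite /= evalpC.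
rewrite (Pdiv.RingMonic.rdivp_eq parameter_poly_monic U) rmorphD rmorphM /=.
rewrite hornerD hornerM (rootP parameter_poly_root) mulr0 add0r -/r.
rewrite (@horner_coef_wide _ (size P)); last first.
  apply: leq_trans (size_poly _ _) (ltnW _).
  by rewrite Pdiv.Ring.ltn_rmodpN0 // monic_neq0 ?parameter_poly_monic.
by apply: eq_bigr => l _; rewrite coef_map.
Qed.

(** The products of a power of t and a basis vector of K over F(t) generate K
  over F(s). *)
Lemma parameter_dependent (x : 'I_(d * size parameter_poly).+1 -> K) :
  exists q : 'I_(d * size parameter_poly).+1 -> {poly F},
    (exists i, q i != 0) /\ \sum_i ev (q i) * x i = 0.
Proof.
have [e [m [e0 em]]] := common_denominator x.
have /choice[r mr] q := parameter_module q.
pose J := ('I_d * 'I_(size parameter_poly))%type.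
have cardJ : #|{: J}| = (d * size parameter_poly)%N by rewrite card_prod !card_ord.
pose idx k : J := enum_val (cast_ord (esym cardJ) k).
have [q [q0 qr]] := dependent_rows (fun i k => r (m i (idx k).1) (idx k).2).
exists q; split=> //; have pe0 : poly_embed e != 0 by rewrite poly_embed_eq0.
apply: (mulfI pe0); rewrite mulr0 mulr_sumr.
pose z (jl : J) := t ^+ jl.2 * (vbasis {:K})`_jl.1.
have ex i : poly_embed e * x i = \sum_k ev (r (m i (idx k).1) (idx k).2) * z (idx k).
  rewrite em.
  have -> : \sum_k ev (r (m i (idx k).1) (idx k).2) * z (idx k) =
            \sum_(jl : J) ev (r (m i jl.1) jl.2) * z jl.
    rewrite [RHS](reindex idx) //; exists (fun jl => cast_ord cardJ (enum_rank jl)).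
      by move=> k _; rewrite /idx enum_valK cast_ordKV.
    by move=> jl _; rewrite /idx cast_ordK enum_rankK.
  rewrite -(pair_bigA _ (fun j l => ev (r (m i j) l) * z (j, l))) /=.
  apply: eq_bigr => j _; rewrite mr mulr_suml; apply: eq_bigr => l _.
  by rewrite mulrA.
under eq_bigr => i _ do rewrite mulrCA ex mulr_sumr.
rewrite exchange_big big1 //= => k _.
under eq_bigr => i _ do rewrite mulrA -rmorphM.
by rewrite -mulr_suml -rmorph_sum qr rmorph0 mul0r.
Qed.

End Normalization.

End FunctionField.

(** * Trees given by a parent function *)

Section ParentTree.
Variables (T : choiceType) (adj : rel T) (parent : T -> T) (level : T -> int).
Hypothesis level_parent : forall x, level (parent x) = level x - 1.
Hypothesis adjP : forall x y, adj x y <-> y = parent x \/ x = parent y.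
Hypothesis parent_confluent :
  forall x y, exists i j, iter i parent x = iter j parent y.
Variable x0 : T.

Lemma parent_adj_sym : symmetric adj.
Proof. by move=> x y; apply/idP/idP => /adjP xy; apply/adjP; case: xy; auto. Qed.

Lemma parent_adj_irr : irreflexive adj.
Proof.
move=> x; apply/negP => /adjP xx.
have /eqP : level x = level x - 1 by case: xx => {1}->; rewrite level_parent.
by lia.
Qed.

Lemma parent_nonempty : exists x : T, True. Proof. by exists x0. Qed.

Lemma parent_connected x y : exists2 c : seq T, path adj x c & last x c = y.
Proof.
pose linked x y := exists2 c : seq T, path adj x c & last x c = y.
have linked_trans u w z : linked u w -> linked w z -> linked u z.
  move=> [c pc lc] [c' pc' lc']; exists (c ++ c'); rewrite ?last_cat ?lc //.
  by rewrite cat_path pc lc.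
have linked_iter i z : linked z (iter i parent z) /\ linked (iter i parent z) z.
  elim: i => [|i [IH1 IH2]]; first by split; exists [::].
  split; [apply: linked_trans IH1 _ | apply: linked_trans IH2];
    [exists [:: parent (iter i parent z)] | exists [:: iter i parent z]] => //=;
    by rewrite andbT; apply/adjP; auto.
have [i [j eqij]] := parent_confluent x y.
apply: linked_trans (linked_iter i x).1 _; rewrite eqij.
exact: (linked_iter j y).2.
Qed.

Lemma seq_max_level x c : exists2 y, y \in x :: c &
  forall z, z \in x :: c -> level z <= level y.
Proof.
elim: c x => [|a c IHc] x.
  by exists x; rewrite ?inE // => z; rewrite inE => /eqP ->.
have [y yc ymax] := IHc a; case: (leP (level x) (level y)) => [lexy|ltyx].
  exists y; first by rewrite inE yc orbT.
  by move=> z; rewrite inE => /predU1P[->|/ymax].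
exists x; rewrite ?inE ?eqxx // => z; rewrite inE => /predU1P[->//|/ymax lezy].
exact: le_trans lezy (ltW ltyx).
Qed.

(** Both neighbours in a circuit of a vertex of highest level are its parent. *)
Lemma parent_acyclic (c : seq T) : ucycle adj c -> (size c <= 2)%N.
Proof.
case: c => // a c ucyc; have [y yc ymax] := seq_max_level a c.
have [i p rotE] := rot_to yc; rewrite -(size_rot i) rotE.
move: ucyc; rewrite -(rot_ucycle i) rotE => /andP[cyc uniqp].
have maxp z : z \in p -> level z <= level y.
  by move=> zp; apply: ymax; rewrite -(mem_rot i) rotE inE zp orbT.
have up z : z \in p -> adj y z -> z = parent y.
  move=> /maxp lezy /adjP[//|yz]; move: lezy; rewrite yz level_parent; lia.
case: p => [|b [|b' p]] // in cyc uniqp maxp up rotE *.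
move: cyc => /=; rewrite rcons_path => /and3P[yb _ /andP[_ ly]].
have eb := up b (mem_head _ _) yb.
have lp : last b' p \in b :: b' :: p by rewrite inE mem_last orbT.
have el : last b' p = parent y by apply: up; rewrite // parent_adj_sym.
have bp : b \in b' :: p by rewrite eb -el mem_last.
by move: uniqp; rewrite 2!cons_uniq bp andbF.
Qed.

Definition parent_tree : tree := Tree parent_adj_sym parent_adj_irr
  parent_nonempty parent_connected parent_acyclic.

End ParentTree.

Section Matrix2.
Variable K : fieldType.
Implicit Types (a b c d : K).

Definition mx2 a b c d : 'M[K]_2 :=
  \matrix_(i, j) if i == 0 then (if j == 0 then a else b)
                 else (if j == 0 then c else d).

Lemma ord2P (P : 'I_2 -> Prop) : P 0 -> P 1 -> forall i, P i.
Proof.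
move=> P0 P1 [[|[|//]] lti].
  by rewrite (_ : Ordinal _ = 0) //; apply: val_inj.
by rewrite (_ : Ordinal _ = 1) //; apply: val_inj.
Qed.

Lemma mx2_eq (A : 'M[K]_2) : A = mx2 (A 0 0) (A 0 1) (A 1 0) (A 1 1).
Proof. by apply/matrixP => i j; elim/ord2P: i; elim/ord2P: j; rewrite !mxE. Qed.

Lemma mulmx2 a b c d a' b' c' d' : mx2 a b c d *m mx2 a' b' c' d' =
  mx2 (a * a' + b * c') (a * b' + b * d') (c * a' + d * c') (c * b' + d * d').
Proof.
apply/matrixP => i j; rewrite !mxE !big_ord_recl big_ord0 addr0 !mxE /=.
by elim/ord2P: i; elim/ord2P: j.
Qed.

Lemma det_mx2 a b c d : \det (mx2 a b c d) = a * d - b * c.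
Proof.
rewrite (expand_det_row _ 0) !big_ord_recl big_ord0 addr0 /cofactor !det_mx11 !mxE /=.
by rewrite expr0 expr1 mul1r mulN1r mulrN.
Qed.

Lemma scalar_mx2 a : a%:M = mx2 a 0 0 a.
Proof. by apply/matrixP => i j; elim/ord2P: i; elim/ord2P: j; rewrite !mxE. Qed.

Lemma scale_mx2 x a b c d : x *: mx2 a b c d = mx2 (x * a) (x * b) (x * c) (x * d).
Proof. by apply/matrixP => i j; elim/ord2P: i; elim/ord2P: j; rewrite !mxE. Qed.

Lemma mx2_all (P : K -> Prop) a b c d :
  (forall i j, P (mx2 a b c d i j)) <-> [/\ P a, P b, P c & P d].
Proof.
split=> [all|[Pa Pb Pc Pd] i j]; last by elim/ord2P: i; elim/ord2P: j; rewrite mxE.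
split; [have := all 0 0 | have := all 0 1 | have := all 1 0 | have := all 1 1];
  by rewrite mxE.
Qed.

Lemma unitmx2 a b c d : (mx2 a b c d \in unitmx) = (a * d - b * c != 0).
Proof. by rewrite unitmxE det_mx2 unitfE. Qed.

Lemma invmx2 a b c d : a * d - b * c != 0 -> invmx (mx2 a b c d) =
  (a * d - b * c)^-1 *: mx2 d (- b) (- c) a.
Proof.
move=> D0; have uA : mx2 a b c d \in unitmx by rewrite unitmx2.
apply: (can_inj (mulmxK uA)); rewrite mulVmx // -scalemxAl mulmx2 scale_mx2.
by rewrite scalar_mx2; congr mx2; field.
Qed.

Lemma GL_det (g : GL 2 K) : \det (val g) != 0.
Proof. by have := valP g; rewrite unitmxE unitfE. Qed.

Lemma GL_mx2 (g : GL 2 K) : exists a b c d,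
  [/\ val g = mx2 a b c d, a * d - b * c != 0 &
      val (g^-1)%g = (a * d - b * c)^-1 *: mx2 d (- b) (- c) a].
Proof.
have D0 := GL_det g; have gE := mx2_eq (val g).
exists (val g 0 0), (val g 0 1), (val g 1 0), (val g 1 1).
by rewrite {1}gE det_mx2 in D0; split=> //; rewrite /= {1}gE invmx2.
Qed.

End Matrix2.

(** * The Bruhat-Tits tree of GL_2 *)

Section BruhatTits.
Variables (K : fieldType) (v : dvaluation K).
Local Notation GL2 := (GL 2 K).
Implicit Types (g h A B : GL2).

(** With j the valuation of the scalar: g is a scalar multiple of an integral
  matrix whose determinant has valuation k.  The lattice classes of A and g A are
  equal for k = 0 and adjacent for k = 1. *)
Definition elementary_position (k : int) (g : GL2) : Prop :=
  exists j : int, v (\det (val g)) = j *+ 2 + k /\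
    forall i i', at_least v j (val g i i').
Local Notation pos := elementary_position.

Lemma mx2_at_least j a b c d : (forall i i', at_least v j (mx2 a b c d i i')) <->
  [/\ at_least v j a, at_least v j b, at_least v j c & at_least v j d].
Proof. exact: (mx2_all (at_least v j)). Qed.

Lemma pos1 : pos 0 1%g.
Proof.
exists 0; split; first by rewrite det1 dval1.
move=> i i'; rewrite /= mxE; case: (i == i'); rewrite ?at_least0 //.
by rewrite /at_least dval1 orbT.
Qed.

Lemma posM k l g h : pos k g -> pos l h -> pos (k + l) (g * h)%g.
Proof.
move=> [i [di gi]] [j [dj hj]]; exists (i + j); split.
  by rewrite /= det_mulmx dvalM ?GL_det // di dj; lia.
move=> a b; rewrite mxE; apply: at_least_sum => c _; exact: at_leastM.
Qed.

Lemma posV k g : pos k g -> pos k g^-1%g.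
Proof.
have [a [b [c [d [gE D0 gV]]]]] := GL_mx2 g.
rewrite /pos gE gV det_mx2 scale_mx2 => -[j [vD /mx2_at_least[ja jb jc jd]]].
have vDV := dvalV v D0.
have Dj x : at_least v j x -> at_least v (- j - k) ((a * d - b * c)^-1 * x).
  move=> jx; have -> : - j - k = - v (a * d - b * c) + j by rewrite vD; lia.
  by apply: at_leastM => //; rewrite /at_least vDV lexx orbT.
exists (- j - k); split; last first.
  by apply/mx2_at_least; split; apply: Dj; rewrite ?at_leastN.
rewrite det_mx2 (_ : _ - _ = (a * d - b * c)^-1); last by field.
by rewrite vDV vD; lia.
Qed.

Lemma pos0V g h : pos 0 (g * h^-1)%g -> pos 0 (h * g^-1)%g.
Proof. by move/posV; rewrite invgM invgK. Qed.

Lemma pos_proj k g h : proj_eq g h -> pos k g -> pos k h.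
Proof.
move=> /proj_eqP[a a0 hE] [j [vD gj]]; exists (v a + j); split.
  by rewrite hE detZ dvalM ?expf_neq0 ?GL_det // vD expr2 dvalM //; lia.
by move=> i i'; rewrite hE mxE; apply: at_leastM; rewrite // /at_least lexx orbT.
Qed.

(** The products of an entry of g and an entry of its inverse do not see the
  scalars. *)
Lemma pos0_entries g i i' k k' :
  pos 0 g -> at_least v 0 (val g i i' * val (g^-1)%g k k').
Proof.
move=> pg; have [j [vD gj]] := pg; have [l [vDV gl]] := posV pg.
have jl : j + l = 0.
  have : v (\det (val g) * \det (val g^-1%g)) = 0.
    by rewrite -det_mulmx -[_ *m _]/(val (g * g^-1)%g) mulgV det1 dval1.
  by rewrite dvalM ?GL_det // vD vDV; lia.
by rewrite -jl; apply: at_leastM.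
Qed.

Definition same_lattice A B : bool := `[< pos 0 (B * A^-1)%g >].

Lemma same_lattice_refl : reflexive same_lattice.
Proof. by move=> A; apply/asboolP; rewrite mulgV; apply: pos1. Qed.
Lemma same_lattice_sym : symmetric same_lattice.
Proof. by move=> A B; apply/asboolP/asboolP => /pos0V. Qed.
Lemma same_lattice_trans : transitive same_lattice.
Proof.
move=> B A C /asboolP AB /asboolP BC; apply/asboolP.
by rewrite -[C](mulgVK B) -mulgA -[0]add0r; apply: posM.
Qed.

Canonical same_lattice_equiv :=
  EquivRel same_lattice same_lattice_refl same_lattice_sym same_lattice_trans.

Definition bt_vertex : Type := {eq_quot same_lattice_equiv}.
HB.instance Definition _ := Choice.on bt_vertex.
HB.instance Definition _ := EqQuotient.on bt_vertex.

Definition lattice_class A : bt_vertex := \pi_bt_vertex A.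
Local Notation cl := lattice_class.

Lemma lattice_classP A B : cl A = cl B <-> pos 0 (B * A^-1)%g.
Proof.
split=> [/(eqmodP same_lattice_equiv)/asboolP //|AB].
exact/(eqmodP same_lattice_equiv)/asboolP.
Qed.

Lemma lattice_class_repr x : cl (repr x) = x.
Proof. exact: reprK. Qed.

Definition bt_adj (x y : bt_vertex) : bool := `[< pos 1 (repr y * (repr x)^-1)%g >].

Lemma pos_repr k A B :
  pos k (repr (cl B) * (repr (cl A))^-1)%g <-> pos k (B * A^-1)%g.
Proof.
have eqA := lattice_class_repr (cl A); have eqB := lattice_class_repr (cl B).
set A' := repr (cl A) in eqA *; set B' := repr (cl B) in eqB *.
have shift C C' D D' : cl C = cl C' -> cl D = cl D' ->
    pos k (D * C^-1)%g -> pos k (D' * C'^-1)%g.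
  move=> /esym/lattice_classP CC /lattice_classP DD p.
  have -> : (D' * C'^-1 = (D' * D^-1) * (D * C^-1) * (C * C'^-1))%g.
    by rewrite !mulgA !mulgVK.
  by rewrite -[k]addr0 -[k in k + 0]add0r; do 2?apply: posM.
by split; apply: shift.
Qed.

Lemma bt_adj_class A B : bt_adj (cl A) (cl B) <-> pos 1 (B * A^-1)%g.
Proof. by rewrite -pos_repr; split=> [/asboolP|?] //; apply/asboolP. Qed.

Definition bt_act g (x : bt_vertex) : bt_vertex := cl (repr x * g^-1)%g.

Lemma bt_act_class g A : bt_act g (cl A) = cl (A * g^-1)%g.
Proof.
apply/lattice_classP; rewrite invgM mulgA invgK mulgVK.
by apply/lattice_classP; apply: lattice_class_repr.
Qed.

Lemma bt_actM g h x : bt_act (g * h)%g x = bt_act g (bt_act h x).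
Proof. by rewrite -[x]lattice_class_repr !bt_act_class invgM mulgA. Qed.

Lemma bt_act1 x : bt_act 1%g x = x.
Proof. by rewrite -[x]lattice_class_repr bt_act_class invg1 mulg1. Qed.

Lemma bt_act_proj g h : proj_eq g h -> bt_act g =1 bt_act h.
Proof.
move=> gh x; rewrite -[x]lattice_class_repr !bt_act_class; apply/lattice_classP.
set A := repr x; rewrite invgM invgK mulgA.
have /proj_eqP[a a0 hE] := gh.
have [b [c [d [e [gE D0 gV]]]]] := GL_mx2 g.
apply: (pos_proj _ pos1); apply/proj_eqP; exists a^-1; first by rewrite invr_eq0.
have hV : val (h^-1)%g = a^-1 *: val (g^-1)%g.
  by rewrite /= hE invmxZ // -hE; apply: (valP h).
rewrite -[LHS]/(val A *m val (h^-1)%g *m val g *m val (A^-1)%g) hV.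
rewrite -scalemxAr -!scalemxAl.
congr (_ *: _); rewrite -[_ *m val g]mulmxA -[val (g^-1)%g *m val g]/(val (g^-1 * g)%g).
by rewrite mulVg mulmx1 -[_ *m _]/(val (A * A^-1)%g) mulgV.
Qed.

Lemma bt_adj_act g x y : bt_adj (bt_act g x) (bt_act g y) = bt_adj x y.
Proof.
rewrite -[x]lattice_class_repr -[y]lattice_class_repr !bt_act_class.
apply/idP/idP => /bt_adj_class p; apply/bt_adj_class; move: p;
  by rewrite invgM invgK mulgA mulgVK.
Qed.

Lemma bt_act_fix g A : bt_act g (cl A) = cl A -> pos 0 (A * g * A^-1)%g.
Proof. by rewrite bt_act_class => /lattice_classP; rewrite invgM invgK mulgA. Qed.

Definition unif : K := projT1 (cid2 (dval_uniformizer v)).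
Local Notation w := unif.
Lemma unif_neq0 : w != 0. Proof. by rewrite /unif; case: cid2. Qed.
Lemma dval_unif : v w = 1. Proof. by rewrite /unif; case: cid2. Qed.

Lemma ball_subproof (a : K) (n : int) : mx2 1 a 0 (w ^ n) \in unitmx.
Proof. by rewrite unitmx2 mul1r mulr0 subr0 expfz_neq0 // unif_neq0. Qed.

(** The lattice spanned by the rows (1, a) and (0, w^n); its class corresponds to
  the ball of centre a and radius |w^n| in K. *)
Definition ball_frame (a : K) (n : int) : GL2 :=
  Sub (mx2 1 a 0 (w ^ n)) (ball_subproof a n).
Definition ball a n : bt_vertex := cl (ball_frame a n).

Lemma dval_wn n : v (w ^ n) = n.
Proof. by rewrite dvalXz ?unif_neq0 // dval_unif mul1r. Qed.

(** The quotient of two frames is triangular: its diagonal compares the radii and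
  its corner the centres. *)
Lemma pos_ball k a b m n : pos k (ball_frame b m * (ball_frame a n)^-1)%g <->
  exists j, [/\ m - n = j *+ 2 + k, j <= 0, j <= m - n & at_least v (j + n) (b - a)].
Proof.
have w0 := unif_neq0; have wn i : w ^ i != 0 by rewrite expfz_neq0.
pose x := (b - a) / w ^ n.
have uX : mx2 1 x 0 (w ^ (m - n)) \in unitmx.
  by rewrite unitmx2 mulr0 subr0 mul1r.
have -> : (ball_frame b m * (ball_frame a n)^-1)%g =
    (Sub (mx2 1 x 0 (w ^ (m - n))) uX : GL2).
  apply: (canLR (mulgK _)); apply: val_inj => /=; rewrite mulmx2.
  congr mx2; rewrite ?mulr1 ?mulr0 ?addr0 ?mul0r ?mul1r ?add0r //.
    by rewrite /x divfK // addrC subrK.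
  by rewrite -expfzDr // subrK.
rewrite /pos /= det_mx2 mulr0 subr0 mul1r dval_wn.
have xj j : at_least v j x = at_least v (j + n) (b - a).
  apply/idP/idP => [xj|]; last first.
    move=> bj; rewrite (_ : j = (j + n) + (- n)); last by lia.
    apply: at_leastM => //; rewrite /at_least (invr_expz w n) dval_wn.
    by rewrite lexx orbT.
  rewrite -(divfK (wn n) (b - a)); apply: at_leastM => //.
  by rewrite /at_least dval_wn lexx orbT.
split=> -[j]; [move=> [jE /mx2_at_least[j1 jx _ jw]] | move=> [jE j0 jmn jx]]; exists j.
  rewrite -xj; split=> //; first by move: j1; rewrite /at_least oner_eq0 dval1.
  by move: jw; rewrite /at_least (negPf (wn _)) dval_wn.
split=> //; apply/mx2_at_least; split; rewrite ?xj ?at_least0 //.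
  by rewrite /at_least dval1 j0 orbT.
by rewrite /at_least dval_wn jmn orbT.
Qed.

Lemma ball_eq a b m n : ball a n = ball b m <-> n = m /\ at_least v n (b - a).
Proof.
rewrite lattice_classP pos_ball; split=> [[j [jE j0 jmn ba]]|[<- ba]].
  have j00 : j = 0 by lia.
  by rewrite j00 add0r in ba; split=> //; lia.
by exists 0; rewrite subrr add0r; split; rewrite // add0r.
Qed.

Lemma bt_adj_ball a b m n : bt_adj (ball a n) (ball b m) <->
  (m = n + 1 /\ at_least v n (b - a)) \/ (m = n - 1 /\ at_least v m (b - a)).
Proof.
rewrite bt_adj_class pos_ball; split=> [[j [jE j0 jmn ba]]|].
  have [j00|j1] : j = 0 \/ j = -1 by lia.
    by left; rewrite j00 add0r in ba; split=> //; lia.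
  right; have mE : m = n - 1 by lia.
  by rewrite mE addrC -j1.
case=> -[mE ba].
  by exists 0; split; [lia | lia | lia | rewrite add0r].
by exists (-1); split; [lia | lia | lia | rewrite addrC -mE].
Qed.

(** Hermite normal form: the column entry of smaller valuation is the pivot. *)
Lemma ball_surj x : exists a n, x = ball a n.
Proof.
rewrite -[x]lattice_class_repr; set g := repr x.
suff [a [n p]] : exists a n, pos 0 (g * (ball_frame a n)^-1)%g.
  by exists a, n; apply/esym/lattice_classP.
have [p [q [r [t [gE D0 _]]]]] := GL_mx2 g.
pose D := p * t - q * r.
have frame a n y z : p * a + y * w ^ n = q -> r * a + z * w ^ n = t ->
    pos 0 (g * (ball_frame a n)^-1)%g <->
    exists j : int, v (\det (mx2 p y r z)) = j *+ 2 + 0 /\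
      forall i i', at_least v j (mx2 p y r z i i').
  move=> yE zE; suff E : val (g * (ball_frame a n)^-1)%g = mx2 p y r z.
    by rewrite /pos E.
  have eM : mx2 p y r z *m val (ball_frame a n) = val g.
    by rewrite mulmx2 gE yE zE; congr mx2; ring.
  rewrite -[LHS]/(val g *m invmx (val (ball_frame a n))) -eM mulmxK //.
  exact: (valP (ball_frame a n)).
have w0 := unif_neq0; have wn i : w ^ i != 0 by rewrite expfz_neq0.
have vdiv y n : y != 0 -> v (y / w ^ n) = v y - n.
  by move=> y0; rewrite dvalM ?invr_eq0 // (invr_expz w n) dval_wn.
have at_v y : at_least v (v y) y by rewrite /at_least lexx orbT.
have pivot y : y != 0 -> v (D / y / w ^ (v D - v y *+ 2)) = v y.
  move=> y0; have vDy : v (D / y) = v D - v y.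
    by rewrite dvalM ?invr_eq0 // dvalV.
  by rewrite vdiv ?mulf_neq0 ?invr_eq0 // vDy; lia.
have at_pivot y : y != 0 -> at_least v (v y) (D / y / w ^ (v D - v y *+ 2)).
  by move=> y0; rewrite -[X in at_least _ X](pivot y y0); apply: at_v.
have pivot0 y : y != 0 -> D / y / w ^ (v D - v y *+ 2) != 0.
  by move=> y0; rewrite !mulf_neq0 ?invr_eq0.
have [[p0 pr]|[r0 rp]] :
  (p != 0 /\ at_least v (v p) r) \/ (r != 0 /\ at_least v (v r) p).
- have [p0|p0] := eqVneq p 0.
    right; rewrite p0 at_least0; split=> //.
    by apply: contraNneq D0 => ->; rewrite p0 mul0r mulr0 subrr.
  have [r0|r0] := eqVneq r 0; first by left; rewrite r0 at_least0.
  case: (leP (v p) (v r)) => le; [left | right]; split=> //.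
    by rewrite /at_least le orbT.
  by rewrite /at_least ltW ?orbT.
- exists (q / p), (v D - v p *+ 2).
  have := pivot0 p p0; have := pivot p p0; have := at_pivot p p0.
  set z := D / p / _ => zp vz z0; apply/(frame _ _ 0 z).
  + by field.
  + by rewrite /z /D; field; rewrite p0 wn.
  exists (v p); rewrite det_mx2 mul0r subr0; split; first by rewrite dvalM // vz; lia.
  by apply/mx2_at_least; split; rewrite ?at_least0.
- exists (t / r), (v D - v r *+ 2).
  have := pivot0 r r0; have := pivot r r0; have := at_pivot r r0.
  set z := D / r / _ => zr vz z0; apply/(frame _ _ (- z) 0).
  + by rewrite /z /D; field; rewrite r0 wn.
  + by field.
  exists (v r); rewrite det_mx2 mulr0 sub0r mulNr opprK; split.
    by rewrite dvalM // vz; lia.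
  by apply/mx2_at_least; split; rewrite ?at_least0 ?at_leastN.
Qed.

Definition ball_coords x : K * int :=
  projT1 (cid (let: ex_intro a (ex_intro n e) := ball_surj x in
    ex_intro (fun an : K * int => x = ball an.1 an.2) (a, n) e)).
Definition bt_level x : int := (ball_coords x).2.
Definition bt_parent x : bt_vertex := ball (ball_coords x).1 (bt_level x - 1).

Lemma ball_coordsK x : x = ball (ball_coords x).1 (bt_level x).
Proof. by rewrite /bt_level /ball_coords; case: cid. Qed.

Lemma bt_level_ball a n : bt_level (ball a n) = n.
Proof. by have /ball_eq[] := ball_coordsK (ball a n). Qed.

Lemma bt_parent_ball a n : bt_parent (ball a n) = ball a (n - 1).
Proof.
have /ball_eq[nE aE] := ball_coordsK (ball a n).
rewrite /bt_parent -nE; apply/ball_eq; split=> //.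
apply: (at_leastW (n := n)); first by lia.
by rewrite -at_leastN opprB.
Qed.

Lemma bt_level_parent x : bt_level (bt_parent x) = bt_level x - 1.
Proof. by rewrite /bt_parent bt_level_ball. Qed.

Lemma bt_adjP x y : bt_adj x y <-> y = bt_parent x \/ x = bt_parent y.
Proof.
have [a [n ->]] := ball_surj x; have [b [m ->]] := ball_surj y.
rewrite bt_adj_ball !bt_parent_ball !ball_eq; split.
  case=> -[mE ba]; [right | left].
    by split; [lia | apply: at_leastW ba; lia].
  by rewrite -at_leastN opprB; split.
case=> -[mE ba]; [right | left].
  by rewrite -at_leastN opprB.
by split; [lia | apply: at_leastW ba; lia].
Qed.

Lemma iter_bt_parent i a n : iter i bt_parent (ball a n) = ball a (n - i%:Z).
Proof.
elim: i => [|i IHi]; first by rewrite subr0.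
by rewrite iterS IHi bt_parent_ball; congr ball; lia.
Qed.

Lemma bt_parent_confluent x y : exists i j, iter i bt_parent x = iter j bt_parent y.
Proof.
have [a [n ->]] := ball_surj x; have [b [m ->]] := ball_surj y.
pose N := Order.min (Order.min n m) (v (b - a)).
have leNn : N <= n by rewrite /N !ge_min lexx.
have leNm : N <= m by rewrite /N !ge_min lexx !orbT.
have leNv : N <= v (b - a) by rewrite /N ge_min lexx orbT.
exists `|n - N|%N, `|m - N|%N; rewrite !iter_bt_parent.
have -> : n - `|n - N|%N%:Z = N by lia.
have -> : m - `|m - N|%N%:Z = N by lia.
by apply/ball_eq; split=> //; rewrite /at_least leNv orbT.
Qed.

Definition bt_tree : tree :=
  parent_tree bt_level_parent bt_adjP bt_parent_confluent (ball 0 0).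

(** The neighbours of a ball are its parent and the maximal balls that it
  contains, one for each residue class. *)
Lemma bt_finite_valence : finite_valence bt_tree.
Proof.
move=> x; have [R resR] := dval_residues v.
have [a [n xE]] := ball_surj x.
pose child r := ball (a + w ^ n * r) (n + 1).
apply: (@sub_finite_set _ _ ([set bt_parent x] `|` child @` [set` R])); last first.
  by rewrite finite_setU; split; [apply: finite_set1 | apply/finite_image/finite_seq].
move=> y /= /bt_adjP[->|yx]; [by left | right].
have [b [m yE]] := ball_surj y.
move: yx; rewrite xE yE bt_parent_ball => /ball_eq[nE ba].
have wn i : w ^ i != 0 by rewrite expfz_neq0 ?unif_neq0.
have [|r rR rP] := resR ((b - a) / w ^ n).
  rewrite -(subrr n); apply: at_leastM => //.
  by rewrite /at_least (invr_expz w n) dval_wn lexx orbT.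
exists r => //; apply/ball_eq; split; first by lia.
rewrite (_ : b - _ = ((b - a) / w ^ n - r) * w ^ n); last by field.
rewrite addrC; apply: at_leastM => //.
by rewrite /at_least dval_wn lexx orbT.
Qed.

End BruhatTits.

(** * Matrices that fix small balls *)

Section FixedBalls.
Variable K : fieldType.
Implicit Types (v : dvaluation K) (g : GL 2 K).

Lemma fix_ball v g a n p q r t : val g = mx2 p q r t ->
    bt_act g (ball v a n) = ball v a n ->
  exists j : int, [/\ v (p * t - q * r) = j *+ 2, at_least v (j - n) r &
    at_least v (j + n) (q + a * (t - p) - a ^+ 2 * r)].
Proof.
move=> gE /bt_act_fix; set A := ball_frame v a n; pose w := unif v.
have wn i : w ^ i != 0 by rewrite expfz_neq0 ?unif_neq0.
pose x := (q + a * (t - p) - a ^+ 2 * r) / w ^ n.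
have E : val (A * g * A^-1)%g = mx2 (p + a * r) x (w ^ n * r) (t - a * r).
  rewrite -[LHS]/(val A *m val g *m invmx (val A)).
  apply: (canLR (mulmxK (valP A))); rewrite gE !mulmx2.
  by congr mx2; rewrite /x -/w; field.
have dE : \det (val (A * g * A^-1)%g) = p * t - q * r.
  by rewrite E det_mx2 /x; field.
case=> j []; rewrite dE addr0 E => vD /mx2_at_least[_ jx jr _].
have wn_least i : at_least v i (w ^ i) by rewrite /at_least dval_wn lexx orbT.
exists j; split=> //.
  rewrite -(mulKf (wn n) r) (invr_expz w n) addrC; exact: at_leastM.
by rewrite -(divfK (wn n) (_ - _)); apply: at_leastM.
Qed.

Variables (R : comNzRingType) (phi : {rmorphism R -> K}).
Variables (I : finType) (v : I -> dvaluation K) (i0 : I).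
Hypothesis integral_vanishing : forall z, integralOver phi z ->
  (forall i, at_least (v i) 0 z) -> at_least (v i0) 1 z -> z = 0.

(** For g = (p, q; r, t) the ratios q^2 / D, r^2 / D and (t - p)^2 / D with the
  determinant D do not see the scalars; they are integral, and the chosen balls
  force them to vanish at one place. *)
Lemma scalar_of_fixed_balls g :
    (forall i k, integralOver phi (val g i k)) ->
    (forall i k, integralOver phi (val (g^-1)%g i k)) ->
    (forall i, bt_act g (ball (v i) 0 0) = ball (v i) 0 0) ->
    bt_act g (ball (v i0) 0 1) = ball (v i0) 0 1 ->
    bt_act g (ball (v i0) 0 (-1)) = ball (v i0) 0 (-1) ->
    bt_act g (ball (v i0) 1 1) = ball (v i0) 1 1 ->
  is_scalar_mx (val g).
Proof.
move=> intg intV fix0 fix1 fixN1 fix11.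
have pos_g i : elementary_position (v i) 0 g.
  have := bt_act_fix (fix0 i).
  have -> : ball_frame (v i) 0 0 = 1%g.
    by apply: val_inj; rewrite /= scalar_mx2.
  by rewrite mul1g invg1 mulg1.
have prod_int i i' k k' : integralOver phi (val g i i' * val (g^-1)%g k k').
  exact: integral_mul.
have prod_least i' j k k' l : at_least (v l) 0 (val g i' j * val (g^-1)%g k k').
  exact: pos0_entries.
have [p [q [r [t [gE D0 gV]]]]] := GL_mx2 g.
set D := p * t - q * r in D0 gV.
rewrite gE gV scale_mx2 in prod_int prod_least.
have square_least (j : int) x : v i0 D = j *+ 2 -> at_least (v i0) (j + 1) x ->
    at_least (v i0) 1 (x ^+ 2 / D).
  move=> vD jx.
  apply: (@at_leastW _ _ _ ((j + 1) + (j + 1) + - (j *+ 2))); first by lia.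
  rewrite expr2; apply: at_leastM; first exact: at_leastM.
  by rewrite /at_least dvalV // vD lexx orbT.
have square0 x : x ^+ 2 / D = 0 -> x = 0.
  by move/eqP; rewrite mulf_eq0 invr_eq0 (negPf D0) orbF expf_eq0 => /eqP.
have q0 : q = 0.
  have [j [vD _]] := fix_ball gE fix1; rewrite mul0r addr0 expr0n mul0r subr0 => jq.
  apply: square0; have qE : q ^+ 2 / D = - (q * (D^-1 * - q)) by ring.
  apply: integral_vanishing; last exact: square_least jq.
    by rewrite qE; apply: integral_opp; have := prod_int 0 1 0 1; rewrite !mxE.
  by move=> i; rewrite qE at_leastN; have := prod_least 0 1 0 1 i; rewrite !mxE.
have r0 : r = 0.
  have [j [vD jr _]] := fix_ball gE fixN1; rewrite opprK in jr.
  apply: square0; have rE : r ^+ 2 / D = - (r * (D^-1 * - r)) by ring.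
  apply: integral_vanishing; last exact: square_least jr.
    by rewrite rE; apply: integral_opp; have := prod_int 1 0 1 0; rewrite !mxE.
  by move=> i; rewrite rE at_leastN; have := prod_least 1 0 1 0 i; rewrite !mxE.
have tp : t - p = 0.
  have [j [vD _]] := fix_ball gE fix11; rewrite q0 r0 add0r mul1r mulr0 subr0 => jt.
  have DE : D = p * t by rewrite /D r0 mulr0 subr0.
  rewrite DE mulf_eq0 negb_or in D0; have /andP[p0 t0] := D0.
  apply: square0; have tE : (t - p) ^+ 2 / D = t * (D^-1 * t) + p * (D^-1 * p) - 1 - 1.
    by rewrite DE; field; rewrite p0 t0.
  have i00 := prod_int 1 1 0 0; have i11 := prod_int 0 0 1 1.
  have l00 := prod_least 1 1 0 0; have l11 := prod_least 0 0 1 1.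
  move: i00 i11 l00 l11; rewrite !mxE /= => i00 i11 l00 l11.
  apply: integral_vanishing; last by apply: square_least jt.
    rewrite tE; do 2!apply: integral_sub (integral1 phi); exact: integral_add.
  have l1 i : at_least (v i) 0 1 by rewrite /at_least dval1 lexx orbT.
  by move=> i; rewrite tE; do 2?apply: at_leastB => //; apply: at_leastD.
apply/is_scalar_mxP; exists p.
by rewrite gE scalar_mx2 q0 r0 (subr0_eq tp).
Qed.

End FixedBalls.

(** * Discrete actions on products of trees *)

Section ProductAction.
Variables (K : fieldType) (n : nat) (v : 'I_n -> dvaluation K).

Definition bt_trees (i : 'I_n) : tree := bt_tree (v i).
Local Notation Y := (prod_vertex bt_trees).
Implicit Types (g h : GL 2 K).

Definition prod_act g (x : Y) : Y := fun i => bt_act g (x i : bt_vertex (v i)).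

Lemma prod_actM g h x : prod_act (g * h)%g x = prod_act g (prod_act h x).
Proof. by apply: functional_extensionality_dep => i; apply: bt_actM. Qed.

Lemma prod_act1 x : prod_act 1%g x = x.
Proof. by apply: functional_extensionality_dep => i; apply: bt_act1. Qed.

Lemma prod_actK g : cancel (prod_act g) (prod_act g^-1%g).
Proof. by move=> x; rewrite -prod_actM mulVg prod_act1. Qed.

Lemma prod_actVK g : cancel (prod_act g^-1%g) (prod_act g).
Proof. by move=> x; rewrite -prod_actM mulgV prod_act1. Qed.

Lemma prod_act_bij g : bijective (prod_act g).
Proof. exact: Bijective (prod_actK g) (prod_actVK g). Qed.

Lemma bt_act_simplex i g (s : set (bt_trees i)) :
  simplex s -> simplex ((bt_act g : bt_trees i -> bt_trees i) @` s).
Proof.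
move=> [x [y [xy ->]]]; exists (bt_act g x), (bt_act g y); split.
  by case: xy => [->|xy]; [left | right; rewrite /= bt_adj_act].
by rewrite image_setU !image_set1.
Qed.

Lemma prod_act_cell1 g (C : set Y) : cell C -> cell (prod_act g @` C).
Proof.
move=> [s ss ->]; exists (fun i => (bt_act g : bt_trees i -> bt_trees i) @` s i).
  by move=> i; apply: bt_act_simplex.
apply/seteqP; split=> [_ [x sx <-] i|x gx]; first by exists (x i).
exists (prod_act g^-1%g x); last exact: prod_actVK.
move=> i; have [u su ux] := gx i.
by rewrite /prod_act -ux -bt_actM mulVg bt_act1.
Qed.

Lemma prod_act_cell g (C : set Y) : cell (prod_act g @` C) <-> cell C.
Proof.
split=> [gC|]; last exact: prod_act_cell1.
rewrite -[C]image_id (_ : id = prod_act g^-1%g \o prod_act g).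
  by rewrite -image_comp; apply: prod_act_cell1.
by apply/funext => x; rewrite /= prod_actK.
Qed.

Definition gl_aut g : AutProd bt_trees :=
  MkAutProd (prod_act_bij g) (prod_act_cell g).

Lemma gl_autM g h : gl_aut (g * h)%g = (gl_aut g * gl_aut h)%g.
Proof. by apply: aut_inj => x; apply: prod_actM. Qed.

Lemma gl_aut_proj g h : proj_eq g h -> gl_aut g = gl_aut h.
Proof.
move=> gh; apply: aut_inj => x; apply: functional_extensionality_dep => i.
exact: bt_act_proj.
Qed.

End ProductAction.

Section Discreteness.
Variables (n : nat) (T : 'I_n -> tree).

Lemma aut_eval_continuous (x : prod_vertex T) :
  continuous ((fun f => f x) : AutProd T -> discrete_topology (prod_vertex T)).
Proof.
move=> f; apply: (@continuous_comp _ _ _ (@aut_to_ptws n T) (fun h => h x)).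
  exact: initial_continuous.
exact: proj_continuous.
Qed.

Lemma nbhs_aut_agree (s : seq (prod_vertex T)) (f : AutProd T) :
  nbhs f [set h : AutProd T | forall x, x \in s -> h x = f x].
Proof.
elim: s => [|x s IHs].
  by apply: filterS filterT => h _ x.
have hx : nbhs f [set h : AutProd T | h x = f x].
  exact: (@aut_eval_continuous x f [set f x] (discrete_set1 _)).
apply: filterS (filterI IHs hx) => h [/= hs hfx] y.
by rewrite inE => /predU1P[->|/hs].
Qed.

(** Two elements of G with the same action on s are equal, which is injectivity
  and also isolates each point of the image. *)
Lemma discrete_subgroup (G : groupType) (rho : {multiplicative G -> AutProd T})
    (s : seq (prod_vertex T)) :
  (forall g, (forall x, x \in s -> rho g x = x) -> g = 1%g) ->
  injective rho /\ discrete_subset (range rho).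
Proof.
move=> fix1.
have fixE g h : (forall x, x \in s -> rho g x = rho h x) -> g = h.
  move=> gh.
  have /fix1 e : forall x, x \in s -> rho (g^-1 * h)%g x = x.
    move=> x xs; apply: (bij_inj (aut_bij (rho g))).
    by rewrite -[LHS]/((rho g * rho (g^-1 * h))%g x) -gmulfM mulVKg gh.
  by rewrite -[h](mulVKg g) e mulg1.
split=> [g h gh|f [g _ <-]]; first by apply: fixE => x _; rewrite gh.
split; first by apply/mem_set; exists g.
exists [set h : AutProd T | forall x, x \in s -> h x = rho g x].
  exact: nbhs_aut_agree.
apply/seteqP; split=> [h /= [hs [g' _ g'h]]|h ->]; last by split=> //; exists g.
by rewrite -g'h; congr (rho _); apply: fixE => x xs; rewrite g'h hs.
Qed.

End Discreteness.

(** * Finitely generated subgroups of PGL_2 *)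

Section IntegralLifts.
Variables (R : comNzRingType) (K : fieldType) (phi : {rmorphism R -> K}).

Definition integral_matrix (A : GL 2 K) : Prop :=
  forall i k, integralOver phi (val A i k).

Lemma integral_matrix1 : integral_matrix 1%g.
Proof. by move=> i k; rewrite mxE; apply: integral_nat. Qed.

Lemma integral_matrixM A B :
  integral_matrix A -> integral_matrix B -> integral_matrix (A * B)%g.
Proof.
move=> intA intB i k; rewrite mxE.
apply: (big_ind (integralOver phi)) => [|x y|l _]; first exact: (mxpoly.integral0 phi).
  exact: integral_add.
exact: integral_mul.
Qed.

Definition has_integral_lift (x : PGL 2 K) : Prop := exists A : GL 2 K,
  [/\ \pi_(PGL 2 K) A = x, integral_matrix A & integral_matrix A^-1%g].

Lemma has_integral_lift1 : has_integral_lift 1%g.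
Proof. by exists 1%g; rewrite invg1; split=> //; apply: integral_matrix1. Qed.

Lemma has_integral_liftF x y :
  has_integral_lift x -> has_integral_lift y -> has_integral_lift (x / y)%g.
Proof.
move=> [A [<- intA intA']] [B [<- intB intB']]; exists (A / B)%g; split.
- by rewrite PGL_piM PGL_piV.
- exact: integral_matrixM.
- by rewrite invgM invgK; apply: integral_matrixM.
Qed.

End IntegralLifts.

Section MultiplicativeGroups.
Variables (G H : groupType) (f : {multiplicative G -> H}).

Lemma multiplicative1 : f 1%g = 1%g.
Proof. by apply: (mulgI (f 1%g)); rewrite -gmulfM !mulg1. Qed.

Lemma multiplicativeF x y : f (x / y)%g = (f x / f y)%g.
Proof. by apply: (mulIg (f y)); rewrite -gmulfM !mulgVK. Qed.

End MultiplicativeGroups.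

Definition matrix_entries (K : fieldType) (A : GL 2 K) : seq K :=
  [seq val A ik.1 ik.2 | ik <- enum {: 'I_2 * 'I_2}].

Lemma mem_matrix_entries (K : fieldType) (A : GL 2 K) i k :
  val A i k \in matrix_entries A.
Proof. by apply/mapP; exists (i, k); rewrite ?mem_enum. Qed.

Theorem linear_group_on_trees (F : finFieldType)
    (K : fieldExtType {fraction {poly F}})
    (Gamma : groupType) (Gamma_fg : finitely_generated Gamma)
    (Gamma_lin : exists rho : {multiplicative Gamma -> PGL 2 K}, injective rho) :
  exists (n : nat) (T : 'I_n -> tree),
    [/\ (0 < n)%N,
        forall i, finite_valence (T i) &
        exists rho : {multiplicative Gamma -> AutProd T},
          injective rho /\ discrete_subset (range rho)].
Proof.
have [rho0 rho0_inj] := Gamma_lin; have [gens gensP] := Gamma_fg.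
pose lift x : GL 2 K := repr (rho0 x).
have lift_pi x : \pi_(PGL 2 K) (lift x) = rho0 x by rewrite /lift reprK.
pose L := flatten
  [seq matrix_entries (lift x) ++ matrix_entries (lift x)^-1%g | x <- gens].
have [c mon_c cL] := common_leading_multiple L.
(* all elements of L become integral over F[s] *)
pose s := normal_parameter K c; pose phi := evalp (@const_embed _ K) s.
have lifts x : has_integral_lift phi (rho0 x).
  have intL y : y \in L -> integralOver phi y.
    by move=> /cL[Q [b [Qy cE]]]; apply: integral_leading mon_c Q b y Qy cE.
  suff: x \in [pred y | `[< has_integral_lift phi (rho0 y) >]] by rewrite inE.
  apply: gensP.
    split=> [|y z]; rewrite !inE.
      by rewrite multiplicative1; apply: has_integral_lift1.
    by rewrite multiplicativeF => ly lz; apply: has_integral_liftF.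
  move=> y ygens; rewrite inE; exists (lift y).
  split=> // i k; apply: intL; apply/flatten_mapP; exists y => //;
    by rewrite mem_cat mem_matrix_entries ?orbT.
have [I [v [i0 vP]]] := @finitely_many_places F K (@const_embed F K) s _
  (parameter_dependent mon_c) (parameter_transcendental mon_c).
pose u (i : 'I_#|I|) := v (enum_val i).
pose T := bt_trees u.
exists #|I|, T; split.
- by apply/card_gt0P; exists i0.
- by move=> i; apply: bt_finite_valence.
pose f x : AutProd T := gl_aut u (lift x).
have fM : {morph f : x y / (x * y)%g}.
  move=> x y; rewrite /f -gl_autM; apply: gl_aut_proj; apply/PGL_piP.
  by rewrite lift_pi gmulfM PGL_piM !lift_pi.
pose rho : {multiplicative Gamma -> AutProd T} :=
  HB.pack f (isMultiplicative.Build _ _ f fM).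
pose balls a n : prod_vertex T := fun i => ball (u i) a n.
(* the base vertex and three of its neighbours *)
exists rho; apply: (discrete_subgroup
  (s := [:: balls 0 0; balls 0 1; balls 0 (-1); balls 1 1])).
move=> x fix_x; apply: rho0_inj; rewrite multiplicative1.
have [A [piA intA intA']] := lifts x.
have rhoE : rho x = gl_aut u A.
  by apply: gl_aut_proj; apply/PGL_piP; rewrite lift_pi piA.
have fixA a n : balls a n \in [:: balls 0 0; balls 0 1; balls 0 (-1); balls 1 1] ->
    forall i, bt_act A (ball (v i) a n) = ball (v i) a n.
  move=> /fix_x; rewrite rhoE => fixb i.
  have := congr1 (fun y : prod_vertex T => y (enum_rank i)) fixb.
  by rewrite /= /prod_act /balls /u enum_rankK.
have : is_scalar_mx (val A).
  apply: (scalar_of_fixed_balls vP intA intA'); do ?move=> i;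
    by apply: fixA; rewrite !inE eqxx ?orbT.
rewrite -piA => scA; apply/PGL_piP; rewrite proj_eq_sym /proj_eq invg1 mul1g.
exact: scA.
Qed.

Theorem theorem3 (p : nat) (p_prime : prime p)
    (K : fieldExtType {fraction {poly 'F_p}})
    (Gamma : groupType) (Gamma_fg : finitely_generated Gamma)
    (Gamma_lin : exists rho : {multiplicative Gamma -> PGL 2 K}, injective rho) :
  exists (n : nat) (T : 'I_n -> tree),
    [/\ (0 < n)%N,
        forall i, finite_valence (T i) &
        exists rho : {multiplicative Gamma -> AutProd T},
          injective rho /\ discrete_subset (range rho)].
Proof. exact: linear_group_on_trees Gamma_fg Gamma_lin. Qed.
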